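(* Let $\Gamma^{BM}_r$ ($r\in\{f,k,p,o\}$) denote the class of $\Gamma^{BM}_r$-spaces. (1) $\Gamma^{BM}_f\subset\Gamma^{BM}_k\subset\Gamma^{BM}_p\subset\Gamma^{BM}_o$. (2) Let $r\in\{o,p\}$, $X\in\Gamma^{BM}_r$ and $Y\in\Gamma^{BM}_k$. Then $X\times Y\in\Gamma^{BM}_r$. (3) Let $r\in\{k,f\}$ and $X_n\in\Gamma^{BM}_r$ for $n\in\omega$. Then $\prod_{n\in\omega}X_n\in\Gamma^{BM}_r$. (4) For $r\in\{f,k,p,o\}$, if $X\in\Gamma^{BM}_r$ and $U\subset X$ is an open subspace, then $U\in\Gamma^{BM}_r$. (5) For $r\in\{f,k,p,o\}$, if $X$ is locally $\Gamma^{BM}_r$ (that is, every point has a neighborhood $U\in\Gamma^{BM}_r$), then $X\in\Gamma^{BM}_r$. (6) Let $X$ be a quasi-regular space. - If $X$ is a metrizable space, a Moore space, a developable space, a semiregular $\sigma$-space, or a semiregular space with a countable network, then $X$ is a $\Gamma^{BM}_f$-space. - If $X$ is a compact space, a $p$-space, or a semiregular strong $\Sigma$-space, then $X$ is a $\Gamma^{BM}_k$-space. - If $X$ is a countably compact space, a semiregular $\Sigma$-space, or a $w\Delta$-space, then $X$ is a $\Gamma^{BM}_p$-space. - If $X$ is a feebly compact space, then $X$ is a $\Gamma^{BM}_o$-space.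
   Context: Let $\mathcal T$ be the topology of $X$, $\mathcal T^*=\mathcal T\setminus\{\varnothing\}$, $\omega=\{0,1,2,\dots\}$. $\mathfrak V(X)$: all sequences $(V_n)_{n\in\omega}$ in $\mathcal T^*$ with $V_{n+1}\subset V_n$. $\mathfrak V_{BM}(X)$: those $(V_n)\in\mathfrak V(X)$ with $\bigcap_nV_n\ne\varnothing$; $\mathfrak V_{BM}^*(X)=\mathfrak V(X)\setminus\mathfrak V_{BM}(X)$. For subsets $M_n\subset X$, $\overline{\mathrm{lt}}_{n}M_n$ is the set of $x\in X$ such that every neighborhood of $x$ meets $M_n$ for infinitely many $n$. $\mathfrak V_o(X)$ (resp. $\mathfrak V_p(X)$): those $(V_n)\in\mathfrak V(X)$ such that $\overline{\mathrm{lt}}_nM_n\cap\bigcap_nV_n\ne\varnothing$ for every sequence $(M_n)$ of nonempty open sets (resp. of one-point sets) with $M_n\subset V_n$ for all $n$. $\mathfrak V_f(X)$: those $(V_n)\in\mathfrak V_{BM}(X)$ such that for some $x\in\bigcap_nV_n$ the family $\{V_n\}$ is a base at $x$. $\mathfrak V_k(X)$: those $(V_n)\in\mathfrak V_{BM}(X)$ such that $M=\bigcap_nV_n$ is compact and $\{V_n\}$ is an outer base of $M$ (every open $W\supset M$ contains some $V_n$). For $\mathcal V\subset\mathfrak V(X)$, the game $BM(X,\mathcal V)$ has two players $\alpha,\beta$: $\alpha$ starts with $U_0=X$; $\beta$ answers $V_0\in\mathcal T^*$, $V_0\subset U_0$; on move $n\ge1$, $\alpha$ chooses $U_n\in\mathcal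 T^*$, $U_n\subset V_{n-1}$, then $\beta$ chooses $V_n\in\mathcal T^*$, $V_n\subset U_n$. $\alpha$ wins if $(V_n)\in\mathcal V$, otherwise $\beta$ wins. Strategies may depend on all previous moves. $X$ is a $\Gamma^{BM}_r$-space if $\alpha$ has a winning strategy in $BM(X,\mathfrak V_r(X)\cup\mathfrak V_{BM}^*(X))$. Quasi-regular: every nonempty open $U$ contains the closure of some nonempty open $V$. Semiregular: there is a base consisting of sets $U$ with $U=\operatorname{Int}\overline U$. Feebly compact: every locally finite family of open sets is finite. For a family $\gamma$ of sets, $\mathrm{st}(x,\gamma)=\bigcup\{U\in\gamma:x\in U\}$. Developable: there are open covers $\gamma_n$ ($n\in\omega$) such that for each $x$ the family $\{\mathrm{st}(x,\gamma_n):n\in\omega\}$ is a base at $x$. Classical classes of generalized metric spaces: a Moore space is a regular developable space; a network is a family of sets such that each open set is a union of members of it; a $\sigma$-space is a space having a network that is a countable union of locally finite families; a $\Sigma$-space (strong $\Sigma$-space) is a space with a $\sigma$-discrete family $\mathcal F$ of closed sets and a cover $\mathcal C$ by closed countably compact (resp. compact) sets such that whenever $C\in\mathcal C$, $C\subset U$, $U$ open, there is $F\in\mathcal F$ with $C\subset F\subset U$; a $w\Delta$-space is a space with open covers $\mathcal G_n$ such that whenever $x_n\in\mathrm{st}(x,\mathcal G_n)$ for all $n$, the sequence $(x_n)$ has a cluster point; a $p$-space is a completely regular space $X$ for which there are families $\mathcal U_n$ ($n\in\omega$) of open subsets of $\beta X$ (Stone-Čech compactification), each covering $X$, with $\bigcap_n\mathrm{st}(x,\mathcal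 U_n)\subset X$ for all $x\in X$. *)

(* Defs.v *)
From HB Require Import structures.
From mathcomp Require Import all_boot all_order all_algebra.
From mathcomp Require Import all_classical all_reals all_analysis.

Set Implicit Arguments.
Unset Strict Implicit.
Unset Printing Implicit Defensive.

Import Order.TTheory GRing.Theory Num.Theory.
Import numFieldNormedType.Exports.

Local Open Scope classical_set_scope.
Local Open Scope ring_scope.

Section Sequences.
Context {X : topologicalType}.
Implicit Types (V M : nat -> set X) (x : X).

Definition upper_lt M : set X :=
  [set x | forall U, nbhs x U -> infinite_set [set n | M n `&` U !=set0]].

Definition base_at x (B : nat -> set X) : Prop :=
  (forall n, open_nbhs x (B n)) /\
  (forall U, nbhs x U -> exists n, B n `<=` U).

Definition outer_base (M : set X) (B : nat -> set X) : Prop :=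
  (forall n, open (B n) /\ M `<=` B n) /\
  (forall W, open W -> M `<=` W -> exists n, B n `<=` W).

End Sequences.

Section SequenceClasses.
Variable X : topologicalType.

Definition frakV : set (nat -> set X) :=
  [set V | forall n, [/\ open (V n), V n !=set0 & V n.+1 `<=` V n]].

Definition frakV_BM : set (nat -> set X) :=
  [set V | frakV V /\ \bigcap_n V n !=set0].

Definition frakV_BM_star : set (nat -> set X) := frakV `\` frakV_BM.

Definition frakV_o : set (nat -> set X) :=
  [set V | frakV V /\
    forall M : nat -> set X,
      (forall n, [/\ open (M n), M n !=set0 & M n `<=` V n]) ->
      upper_lt M `&` \bigcap_n V n !=set0].

Definition frakV_p : set (nat -> set X) :=
  [set V | frakV V /\
    forall y : nat -> X, (forall n, [set y n] `<=` V n) ->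
      upper_lt (fun n => [set y n]) `&` \bigcap_n V n !=set0].

Definition frakV_f : set (nat -> set X) :=
  [set V | frakV_BM V /\ exists2 x, (\bigcap_n V n) x & base_at x V].

Definition frakV_k : set (nat -> set X) :=
  [set V | [/\ frakV_BM V, compact (\bigcap_n V n)
             & outer_base (\bigcap_n V n) V]].

End SequenceClasses.

Arguments frakV : clear implicits.
Arguments frakV_BM : clear implicits.
Arguments frakV_BM_star : clear implicits.
Arguments frakV_o : clear implicits.
Arguments frakV_p : clear implicits.
Arguments frakV_f : clear implicits.
Arguments frakV_k : clear implicits.

Section Game.
Variable X : topologicalType.

(* A strategy of alpha maps the list of completed rounds
   (U_0, V_0), ..., (U_n, V_n) to the set U_{n+1}; U_0 = X is forced. *)
Definition alpha_strategy := seq (set X * set X) -> set X.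

Definition legal_move (A B : set X) : Prop := [/\ open A, A !=set0 & A `<=` B].

Definition follows (s : alpha_strategy) (U V : nat -> set X) : Prop :=
  U 0%N = [set: X] /\
  forall n, U n.+1 = s (mkseq (fun i => (U i, V i)) n.+1).

(* The first clause makes s answer legally at every finite position reached
   by legal moves of beta; V is arbitrary beyond that position.  If X is
   empty, beta has no legal move and every s is winning. *)
Definition winning_strategy (W : set (nat -> set X)) (s : alpha_strategy) :=
  forall U V : nat -> set X, follows s U V ->
    (forall n, (forall i, (i <= n)%N -> legal_move (V i) (U i)) ->
       legal_move (U n.+1) (V n)) /\
    ((forall n, legal_move (V n) (U n)) -> W V).

Definition alpha_wins_BM (W : set (nat -> set X)) : Prop :=
  exists s : alpha_strategy, winning_strategy W s.

End Game.

Inductive BM_index := BM_f | BM_k | BM_p | BM_o.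

Definition frakV_ (r : BM_index) (X : topologicalType) : set (nat -> set X) :=
  match r with
  | BM_f => frakV_f X
  | BM_k => frakV_k X
  | BM_p => frakV_p X
  | BM_o => frakV_o X
  end.

Arguments frakV_ : clear implicits.

Definition Gamma_BM (r : BM_index) (X : topologicalType) : Prop :=
  alpha_wins_BM (frakV_ r X `|` frakV_BM_star X).

Definition locally_Gamma_BM (r : BM_index) (X : topologicalType) : Prop :=
  forall x : X, exists2 U : set X, nbhs x U & Gamma_BM r (set_type U).

Section Families.
Context {X : topologicalType}.
Implicit Types F G : set (set X).

Definition locally_finite F : Prop :=
  forall x : X, exists2 U, nbhs x U &
    finite_set [set A | F A /\ A `&` U !=set0].

Definition discrete_family F : Prop :=
  forall x : X, exists2 U, nbhs x U &
    forall A B, F A -> F B -> A `&` U !=set0 -> B `&` U !=set0 -> A = B.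

Definition sigma_discrete F : Prop :=
  exists2 D : nat -> set (set X),
    (forall n, discrete_family (D n)) & F = \bigcup_n D n.

Definition open_cover G : Prop :=
  (forall A, G A -> open A) /\ \bigcup_(A in G) A = [set: X].

Definition star (x : X) G : set X := \bigcup_(A in [set A | G A /\ A x]) A.

Definition network F : Prop :=
  forall U : set X, open U -> exists2 G, G `<=` F & U = \bigcup_(A in G) A.

Definition countably_compact (A : set X) : Prop :=
  forall U : nat -> set X, (forall n, open (U n)) -> A `<=` \bigcup_n U n ->
    exists2 D : set nat, finite_set D & A `<=` \bigcup_(n in D) U n.

End Families.

Section SpaceClasses.
Variable X : topologicalType.

Definition quasi_regular : Prop :=
  forall U : set X, open U -> U !=set0 ->
    exists V : set X, [/\ open V, V !=set0 & closure V `<=` U].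

Definition semiregular : Prop :=
  exists2 B : set (set X), basis B & forall U, B U -> regopen U.

Definition feebly_compact : Prop :=
  forall F : set (set X), (forall A, F A -> open A) -> locally_finite F ->
    finite_set F.

Definition metrizable (R : realType) : Prop :=
  exists (M : metricType R) (f : X -> M) (g : M -> X),
    [/\ cancel f g, cancel g f, continuous f & continuous g].

Definition developable : Prop :=
  exists2 G : nat -> set (set X), (forall n, open_cover (G n)) &
    forall x : X, base_at x (fun n => star x (G n)).

Definition Moore_space : Prop := regular_space X /\ developable.

Definition has_countable_network : Prop :=
  exists2 N : set (set X), countable N & network N.

Definition sigma_space : Prop :=
  exists2 N : nat -> set (set X), (forall n, locally_finite (N n)) &
    network (\bigcup_n N n).

Definition Sigma_space_for (P : set X -> Prop) : Prop :=
  exists F C : set (set X),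
    [/\ sigma_discrete F /\ (forall A, F A -> closed A),
        \bigcup_(K in C) K = [set: X],
        (forall K, C K -> closed K /\ P K)
      & forall K U, C K -> open U -> K `<=` U ->
          exists2 A, F A & K `<=` A /\ A `<=` U].

Definition Sigma_space : Prop := Sigma_space_for countably_compact.

Definition strong_Sigma_space : Prop := Sigma_space_for compact.

Definition wDelta_space : Prop :=
  exists2 G : nat -> set (set X), (forall n, open_cover (G n)) &
    forall (x : X) (y : nat -> X), (forall n, star x (G n) (y n)) ->
      cluster (y @ \oo) !=set0.

End SpaceClasses.

(* The Stone-Cech compactification, as the closure of the canonical image of X
   in the product of copies of R indexed by C(X, [0, 1]). *)
Section StoneCech.
Variables (R : realType) (X : topologicalType).

Definition unit_fun : Type :=
  {f : X -> R | continuous f /\ range f `<=` `[0, 1]%classic}.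

Definition unit_fun_eval (x : X) : prod_topology (fun _ : unit_fun => R) :=
  fun f => proj1_sig f x.

Definition stone_cech : topologicalType :=
  set_type (closure (range unit_fun_eval)).

Definition stone_cech_in (x : X) : stone_cech :=
  exist _ (unit_fun_eval x)
    (mem_set (subset_closure (imageT unit_fun_eval x))).

(* Complete regularity includes T1, so that stone_cech_in is an embedding. *)
Definition p_space : Prop :=
  [/\ completely_regular_space X, accessible_space X
    & exists U : nat -> set (set stone_cech),
        [/\ forall n A, U n A -> open A,
            forall n, range stone_cech_in `<=` \bigcup_(A in U n) A
          & forall x : X,
              \bigcap_n star (stone_cech_in x) (U n) `<=` range stone_cech_in]].

End StoneCech.

(* Main.v *)
From HB Require Import structures.
Require Import Defs.
From mathcomp Require Import all_boot all_order all_algebra.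
From mathcomp Require Import all_classical all_reals all_analysis.

(** All four winning conditions speak of a decreasing sequence of nonempty open
    sets [V_n], and alpha only has to care about the plays whose intersection is
    nonempty ([alpha_targetP]).

    Two reductions make the games tractable.  First, replies of alpha may be
    taken to depend on the moves of beta alone and to be legal after every
    sequence of nonempty open sets ([wins_from], [alpha_winsP]); winning from a
    set [O] other than the whole space then makes sense.  Second, alpha may play
    with private notes, for instance the boxes that stand for a play on each
    factor of a product ([wins_from_notes]).

    The classes f and k are convergence conditions on filters.  A sequence of
    class k is one for which every ultrafilter containing all [V_n] converges to
    a point of the intersection ([frakV_kI], [frakV_k_cvg]); class f asks for one
    point that serves all these filters ([frakV_fI], [frakV_f_cvg]).  In this form
    both classes pass to boxes of a countable product coordinate by coordinate.
    A factor of class k never destroys cluster points, since the filter generated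
    by its coordinates above a neighborhood of the other coordinate clusters
    inside the intersection ([upper_lt_setX]); this is the product theorem for
    o and p.  In a product of countably many spaces alpha starts the game of
    factor [i] at round [i], so that at each round only finitely many coordinates
    are restricted, and all the factor games are nevertheless played to the end
    ([Gamma_prod]).

    Open subspaces and the local property come from transporting the classes
    along an injective continuous map ([frakV_image_of], [frakV_of_image]): beta's
    first move is shrunk into a neighborhood on which alpha can win, and the rest
    of the play takes place there ([Gamma_locally]).

    For the classical classes the strategy is memoryless: at round [n] alpha
    shrinks beta's set until it fulfils the [n]-th requirement
    ([Gamma_by_goals]), in a quasi-regular space with closure inside beta's set
    ([closure_goals]), so that every cluster point of the play falls into the
    intersection.  The requirement is to lie in one member of the [n]-th cover for
    developable and w-Delta spaces, to be on one side of the closure of each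
    member of the [n]-th family for networks and Sigma-spaces ([decides]), and to
    have its closure in the Stone-Cech compactification inside a member of the
    [n]-th family for p-spaces. *)

Section BanachMazurGames.
Local Set Implicit Arguments.
Local Unset Strict Implicit.
Local Open Scope classical_set_scope.
Import Order.TTheory GRing.Theory Num.Theory.
Import numFieldNormedType.Exports.

Implicit Types X : topologicalType.

(** * Strategies *)
(** [u] reads only the moves of beta, and answers legally even after sequences of
    moves that are not legal against it; totality removes all bookkeeping about
    legal positions from the constructions below.  Starting from [O] instead of
    the whole space is what makes games on open subsets and games that begin
    after beta's first move comparable with games on the whole space. *)
Definition wins_from X (O : set X) (W : set (nat -> set X)) : Prop :=
  exists u : seq (set X) -> set X,
    [/\ u [::] = O,
        forall vs V, open V -> V !=set0 -> legal_move (u (rcons vs V)) V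
      & forall V, (forall n, legal_move (V n) (u (mkseq V n))) -> W V].

(** A strategy that is legal on the plays against it becomes total by answering
    with beta's own last move wherever it would be illegal; no play that follows
    the strategy sees the difference. *)
Lemma wins_from_legal X (O : set X) W (u : seq (set X) -> set X) :
  u [::] = O ->
  (forall V n, (forall i, (i <= n)%N -> legal_move (V i) (u (mkseq V i))) ->
    legal_move (u (mkseq V n.+1)) (V n)) ->
  (forall V, (forall n, legal_move (V n) (u (mkseq V n))) -> W V) ->
  wins_from O W.
Proof.
move=> u0 uL uW.
pose u' vs := if vs is [::] then O else
  if `[< legal_move (u vs) (last setT vs) >] then u vs else last setT vs.
have u'rcons vs V : u' (rcons vs V) =
    if `[< legal_move (u (rcons vs V)) V >] then u (rcons vs V) else V.
  rewrite /u'; case E: (rcons vs V) => [|A s]; first by case: (vs) E.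
  by rewrite -E last_rcons.
exists u'; split => // [vs V oV V0|V HV].
  rewrite u'rcons; case: asboolP => // _; split => //.
have u'E n : u' (mkseq V n) = u (mkseq V n).
  elim/ltn_ind: n => -[_|n IH]; first by rewrite /= u0.
  rewrite mkseqS u'rcons; case: asboolP => // -[]; rewrite -mkseqS; apply: uL.
  by move=> i ni; rewrite -IH.
by apply: uW => n; rewrite -u'E.
Qed.

(** The moves of alpha in a finite play are determined by those of beta, hence the
    history of pairs can be rebuilt from the second components. *)
Lemma alpha_winsP X (W : set (nat -> set X)) :
  alpha_wins_BM W <-> wins_from setT W.
Proof.
split=> [[s sW]|[u [u0 uL uW]]].
(* [pos vs] is the history in which beta played [vs] against [s]. *)
- pose cur h := if h is [::] then [set: X] else s h.
  pose pos := foldl (fun h V => rcons h (cur h, V)) [::].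
  pose U (V : nat -> set X) n := cur (pos (mkseq V n)).
  have posE V n : pos (mkseq V n) = mkseq (fun i => (U V i, V i)) n.
    by elim: n => // n IH; rewrite !mkseqS -IH /pos foldl_rcons.
  have folU V : follows s (U V) V.
    by split=> // n; rewrite {1}/U posE.
  apply: (@wins_from_legal _ _ _ (cur \o pos)) => // V; have [sL] := sW _ _ (folU V).
    by move=> _ n; apply: sL.
  by move=> +; apply.
- exists (fun h => u (map snd h)) => U V [U0 US].
  have UE n : U n = u (mkseq V n).
    case: n => [|n]; first by rewrite U0 /= u0.
    by rewrite US -map_comp.
  split=> [n /(_ n (leqnn n)) [oV V0 _]|VL].
    by rewrite UE mkseqS; apply: uL.
  by apply: uW => n; rewrite -UE.
Qed.

(** The form in which strategies are built: at each round alpha writes a note [d]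
    chosen so that [P] holds, and her territory [out] is read off the notes. *)
Lemma wins_from_notes X (O : set X) W (D : Type) (d0 : D)
    (out : seq D -> set X) (P : seq D -> set X -> D -> Prop) :
  out [::] = O ->
  (forall ds V, legal_move V (out ds) ->
    exists d, P ds V d /\ legal_move (out (rcons ds d)) V) ->
  (forall V d, (forall n, legal_move (V n) (out (mkseq d n))) ->
    (forall n, P (mkseq d n) (V n) (d n)) -> W V) ->
  wins_from O W.
Proof.
move=> out0 outL outW.
have /choice [note noteP] : forall dV : seq D * set X, exists d,
    legal_move dV.2 (out dV.1) ->
    P dV.1 dV.2 d /\ legal_move (out (rcons dV.1 d)) dV.2.
  move=> [ds V]; have [/outL [d Hd]|nL] := pselect (legal_move V (out ds)).
    by exists d.
  by exists d0.
pose notes := foldl (fun ds V => rcons ds (note (ds, V))) [::].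
have notesE V n :
    notes (mkseq V n) = mkseq (fun i => note (notes (mkseq V i), V i)) n.
  by elim: n => // n IH; rewrite [in RHS]mkseqS -IH mkseqS /notes foldl_rcons.
apply: (@wins_from_legal _ _ _ (out \o notes)) => // V.
  move=> n /(_ n (leqnn n)) /= VL; rewrite mkseqS /notes foldl_rcons.
  by have [] := noteP (notes (mkseq V n), V n) VL.
move=> /= VL; apply: (outW _ (fun i => note (notes (mkseq V i), V i))) => n.
  by rewrite -notesE.
by rewrite -notesE; have [] := noteP (notes (mkseq V n), V n) (VL n).
Qed.

Lemma frakV_le X (V : nat -> set X) m n :
  frakV X V -> (m <= n)%N -> V n `<=` V m.
Proof.
move=> VV; elim: n => [|n IH]; first by rewrite leqn0 => /eqP ->.
rewrite leq_eqVlt => /orP[/eqP -> //|/IH].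
by apply: subset_trans; have [] := VV n.
Qed.

Lemma play_frakV X (u : seq (set X) -> set X) V :
  (forall vs V, open V -> V !=set0 -> legal_move (u (rcons vs V)) V) ->
  (forall n, legal_move (V n) (u (mkseq V n))) -> frakV X V.
Proof.
move=> uL VL n; have [oV V0 _] := VL n; split=> //.
have [_ _ /subset_trans] := VL n.+1; apply.
by rewrite mkseqS; have [] := uL (mkseq V n) _ oV V0.
Qed.

Definition alpha_target r X : set (nat -> set X) :=
  frakV_ r X `|` frakV_BM_star X.
Arguments alpha_target : clear implicits.

Lemma alpha_targetP r X (V : nat -> set X) : frakV X V ->
  alpha_target r X V <-> (\bigcap_n V n !=set0 -> frakV_ r X V).
Proof.
move=> VV; split=> [[//|[_ nBM] V0]|H]; first by exfalso; apply: nBM.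
have [V0|V0] := pselect (\bigcap_n V n !=set0); first by left; apply: H.
by right; split=> // -[].
Qed.

(** Memoryless strategies.  As [P] passes to smaller sets, a goal reached by
    alpha's move [U] is still reached by beta's next move. *)
Lemma Gamma_by_goals r X (P : nat -> set X -> set X -> Prop) :
  (forall n V A B, A `<=` B -> P n V B -> P n V A) ->
  (forall n V, open V -> V !=set0 -> exists U, legal_move U V /\ P n V U) ->
  (forall V, frakV X V -> \bigcap_n V n !=set0 ->
    (forall n, P n (V n) (V n.+1)) -> frakV_ r X V) ->
  Gamma_BM r X.
Proof.
move=> Panti Pex PW; apply/alpha_winsP.
apply: (@wins_from_notes X _ _ _ setT (last setT)
   (fun Us V U => legal_move U V /\ P (size Us) V U)) => //.
  move=> Us V [oV V0 _]; have [U [UL PU]] := Pex (size Us) V oV V0.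
  by exists U; rewrite last_rcons.
move=> V U VL UP.
have VU n : V n.+1 `<=` U n.
  by have [_ _] := VL n.+1; rewrite mkseqS last_rcons.
have VV : frakV X V.
  move=> n; have [? ? _] := VL n; split=> //.
  by apply: subset_trans (VU n) _; have [[]] := UP n.
apply/alpha_targetP => // V0; apply: PW => // n.
apply: Panti (VU n) _; have [_] := UP n.
by rewrite size_mkseq.
Qed.

(** * Filters and the four classes of sequences *)
Lemma upper_ltP X (M : nat -> set X) x :
  upper_lt M x <->
  forall U N, nbhs x U -> exists2 n, (N <= n)%N & M n `&` U !=set0.
Proof.
split=> [H U N Ux|H U Ux].
  apply: contrapT => nH; apply: (H U Ux).
  apply: (sub_finite_set _ (finite_II N)) => n /= Mn.
  by rewrite ltnNge; apply/negP => Nn; apply: nH; exists n.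
move=> /finite_seqP[s sE].
have [n Nn MU] := H U (\max_(i <- s) i).+1 Ux.
have ns : n \in s by have : [set` s] n by rewrite -sE.
by move: Nn; rewrite ltnNge (@leq_bigmax_seq _ s xpredT id n ns).
Qed.

(** [K] need not belong to [G], so compactness is applied to the filter generated
    by the traces of the closures on [K]: a trace is nonempty since otherwise the
    complement of the closure would be an open set around [K]. *)
Lemma compact_outer_cluster X (K : set X) (G : set_system X) :
  compact K -> ProperFilter G ->
  (forall W, open W -> K `<=` W -> G W) -> K `&` cluster G !=set0.
Proof.
move=> Kc GP GW.
have KP : ProperFilter (filter_from G (fun A => K `&` closure A)).
  apply: filter_from_proper.
    apply: filter_from_filter; first by exists setT; apply: filterT.
    move=> A B GA GB; exists (A `&` B); first exact: filterI.
    by move=> x [Kx /closureI [? ?]].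
  move=> A GA; apply: contrapT => H.
  have /filter_ex [x [Ax]] : G (A `&` ~` closure A).
    apply: filterI => //; apply: GW; first by rewrite openC; apply: closed_closure.
    by move=> x Kx cx; apply: H; exists x.
  by apply; apply: subset_closure.
have [x [Kx cx]] : K `&` cluster (filter_from G (fun A => K `&` closure A)) !=set0.
  by apply: Kc; exists setT; [apply: filterT|move=> x []].
exists x; split=> //; rewrite clusterE => A GA.
rewrite (_ : closure A = closure (closure A)); last first.
  exact/closure_id/closed_closure.
move: cx; rewrite clusterE => cx; apply: (closureS (@subIsetr _ K _)).
by apply: cx; exists A.
Qed.

Lemma frakV_k_cluster X (V : nat -> set X) (G : set_system X) :
  frakV_k X V -> ProperFilter G -> (forall n, G (V n)) ->
  \bigcap_n V n `&` cluster G !=set0.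
Proof.
move=> [_ Vc [_ VW]] GP GV; apply: compact_outer_cluster => // W oW /(VW W oW) [n].
by move=> /filterS; apply.
Qed.

(** The sets [V n `\` W] generate a proper filter; this turns convergence of
    ultrafilters into the statement that the [V n] form a base or an outer base. *)
Lemma ultra_escape X (V : nat -> set X) (W : set X) :
  frakV X V -> (forall n, ~ V n `<=` W) ->
  exists G, [/\ UltraFilter G, forall n, G (V n) & ~ G W].
Proof.
move=> VV VW.
have FP : ProperFilter (filter_from [set: nat] (fun n => V n `\` W)).
  apply: filter_from_proper.
    apply: filter_from_filter; first by exists 0%N.
    move=> m n _ _; exists (maxn m n) => // x [Vx Wx]; split; split=> //.
      exact: frakV_le (leq_maxl m n) _ Vx.
    exact: frakV_le (leq_maxr m n) _ Vx.
  move=> n _; apply: contrapT => H; apply: (VW n) => x Vx.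
  by apply: contrapT => Wx; apply: H; exists x.
have [G [GU FG]] := ultraFilterLemma FP.
exists G; split=> // [n|GW]; first by apply: FG; exists n => // x [].
have GC : G (~` W) by apply: FG; exists 0%N => // x [].
by have /filter_ex [x []] : G (W `&` ~` W) by apply: filterI.
Qed.

Lemma frakV_kI X (V : nat -> set X) :
  frakV X V -> \bigcap_n V n !=set0 ->
  (forall G, UltraFilter G -> (forall n, G (V n)) ->
    exists2 x, (\bigcap_n V n) x & G --> x) -> frakV_k X V.
Proof.
move=> VV V0 VG; split=> //.
  rewrite compact_ultra => G GU GV; have [|x Vx Gx] := VG G GU; last by exists x.
  by move=> n; apply: filterS GV => x; apply.
split=> [n|W oW VW]; first by split; [have [] := VV n|move=> x; apply].
apply: contrapT => nW; have [|G [GU GV nGW]] := ultra_escape VV (W := W).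
  by move=> n Vn; apply: nW; exists n.
have [x Vx Gx] := VG G GU GV; apply/nGW/Gx/open_nbhs_nbhs.
by split=> //; apply: VW.
Qed.

Lemma frakV_k_cvg X (V : nat -> set X) (G : set_system X) :
  frakV_k X V -> UltraFilter G -> (forall n, G (V n)) ->
  exists2 x, (\bigcap_n V n) x & G --> x.
Proof.
move=> VK GU /(frakV_k_cluster VK _) [x [Vx]].
by rewrite ultra_cvg_clusterE; exists x.
Qed.

Lemma frakV_fI X (V : nat -> set X) x :
  frakV X V -> (\bigcap_n V n) x ->
  (forall G, UltraFilter G -> (forall n, G (V n)) -> G --> x) -> frakV_f X V.
Proof.
move=> VV Vx VG; split; first by split=> //; exists x.
exists x => //; split=> [n|U Ux]; first by split; [have [] := VV n|apply: Vx].
apply: contrapT => nU; have [|G [GU GV nGU]] := ultra_escape VV (W := U).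
  by move=> n Vn; apply: nU; exists n.
exact/nGU/(VG G).
Qed.

Lemma frakV_f_cvg X (V : nat -> set X) :
  frakV_f X V -> exists2 x, (\bigcap_n V n) x &
    forall G, Filter G -> (forall n, G (V n)) -> G --> x.
Proof.
move=> [_ [x Vx [_ VU]]]; exists x => // G GF GV U /VU [n].
by move=> /filterS; apply.
Qed.

Lemma frakV_f_k X : frakV_f X `<=` frakV_k X.
Proof.
move=> V Vf; have [x Vx Vcvg] := frakV_f_cvg Vf; have [[VV V0] _] := Vf.
by apply: frakV_kI => // G GU GV; exists x => //; apply: Vcvg.
Qed.

Lemma frakV_k_p X : frakV_k X `<=` frakV_p X.
Proof.
move=> V VK; have [[VV _] _ _] := VK; split=> // y yV.
have GV n : (y @ \oo) (V n).
  exists n => // m /= nm; apply: (frakV_le VV nm); exact: yV.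
have [x [Vx cx]] := frakV_k_cluster VK _ GV.
exists x; split=> //; apply/upper_ltP => U N Ux.
have [|z [[n Nn <-] Uz]] := cx [set y n | n in [set n | (N <= n)%N]] U _ Ux.
  by exists N => // n /= Nn; exists n.
by exists n => //; exists (y n).
Qed.

Lemma upper_lt_sub X (M M' : nat -> set X) :
  (forall n, M n `<=` M' n) -> upper_lt M `<=` upper_lt M'.
Proof.
move=> MM' x /upper_ltP H; apply/upper_ltP => U N Ux.
by have [n Nn [z [/MM' ? ?]]] := H U N Ux; exists n => //; exists z.
Qed.

Lemma upper_lt_shift X (M : nat -> set X) :
  upper_lt (fun n => M n.+1) `<=` upper_lt M.
Proof.
move=> x /upper_ltP H; apply/upper_ltP => U N Ux.
by have [n Nn ?] := H U N Ux; exists n.+1 => //; apply: leqW.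
Qed.

Lemma frakV_p_o X : frakV_p X `<=` frakV_o X.
Proof.
move=> V [VV Vp]; split=> // M MV.
have /choice [y yM] : forall n, exists y, M n y by move=> n; have [] := MV n.
have [n _ ->|x [yx Vx]] := Vp y; first by have [_ _] := MV n; apply.
by exists x; split=> //; apply: upper_lt_sub yx => n _ ->.
Qed.

(** A strategy controls the auxiliary sets [A n] it plays with rather than the
    moves of beta squeezed between them. *)
Lemma frakV_interleave r X (A V : nat -> set X) :
  frakV X V -> frakV_ r X A -> (forall n, A n `<=` V n) ->
  (forall n, V n.+1 `<=` A n) -> frakV_ r X V.
Proof.
move=> VV HA AV VA.
have capE : \bigcap_n V n = \bigcap_n A n.
  apply/seteqP; split=> x Hx n _; [exact/VA/Hx|exact/AV/Hx].
case: r HA => /=.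
- move=> [[AA A0] [x Ax [_ AU]]]; split; first by split=> //; rewrite capE.
  exists x; first by rewrite capE.
  split=> [n|U /AU [n An]]; last by exists n.+1; apply: subset_trans (VA n) An.
  by split; [have [] := VV n|apply/AV/Ax].
- move=> [[AA A0] Ac [_ AW]]; rewrite /frakV_k /= capE; split=> //.
    by split=> //; rewrite capE.
  split=> [n|W oW /(AW W oW) [n An]].
    by split; [have [] := VV n|move=> x Ax; apply/AV/Ax].
  by exists n.+1; apply: subset_trans (VA n) An.
- move=> [AA Ap]; split=> // y yV; have [n|x [yx Ax]] := Ap (fun n => y n.+1).
    exact: subset_trans (yV n.+1) (VA n).
  by exists x; rewrite capE; split=> //; apply: (@upper_lt_shift X (fun n => [set y n])).
- move=> [AA Ao]; split=> // M MV; have [n|x [Mx Ax]] := Ao (fun n => M n.+1).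
    by have [? ? MV'] := MV n.+1; split=> //; apply: subset_trans MV' (VA n).
  by exists x; rewrite capE; split=> //; apply: upper_lt_shift.
Qed.

Lemma Gamma_le r r' X : frakV_ r X `<=` frakV_ r' X ->
  Gamma_BM r X -> Gamma_BM r' X.
Proof.
move=> rr' [s sW]; exists s => U V /sW [sL sV]; split=> // /sV [/rr' ?|?].
  by left.
by right.
Qed.

(** * Products of two spaces *)
Section BinaryProduct.

Variables X Y : topologicalType.
Implicit Types (A M : nat -> set X) (B N : nat -> set Y).

Lemma open_setX (A : set X) (B : set Y) : open A -> open B -> open (A `*` B).
Proof.
move=> oA oB; rewrite openE => -[x y] [/= Ax By]; exists (A, B) => //.
by split; apply: open_nbhs_nbhs.
Qed.

Lemma open_box (V : set (X * Y)) x y : open V -> V (x, y) ->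
  exists C D, [/\ open C /\ C x, open D /\ D y & C `*` D `<=` V].
Proof.
move=> oV Vxy; have [[A B] /= [Ax By] ABV] : nbhs (x, y) V by apply: open_nbhs_nbhs.
exists A°, B°; split.
- by split; [apply: open_interior|apply: Ax].
- by split; [apply: open_interior|apply: By].
- by move=> [a b] [/= /interior_subset Aa /interior_subset Bb]; apply: ABV.
Qed.

Lemma bigcap_setX A B : \bigcap_n (A n `*` B n) = \bigcap_n A n `*` \bigcap_n B n.
Proof.
apply/seteqP; split=> -[x y]; first by move=> H; split=> n _; have [] := H n I.
by move=> [Ax By] n _; split; [apply: Ax|apply: By].
Qed.

(** Since [X] need not be first countable, no subsequence can be extracted.
    Instead, each neighborhood [U] of [x] and each [n] give the nonempty set of the
    points lying in some [N m], [m >= n], such that [M m] meets [U]; a cluster point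
    [y] of the filter they generate is the second coordinate. *)
Lemma upper_lt_setX B M N x : frakV_k Y B ->
  (forall n, N n !=set0) -> (forall n, N n `<=` B n) -> upper_lt M x ->
  exists2 y, (\bigcap_n B n) y & upper_lt (fun n => M n `*` N n) (x, y).
Proof.
move=> BK N0 NB /upper_ltP Mx; have [[BB _] _ _] := BK.
pose D : set (set X * nat) := [set Un | nbhs x Un.1].
pose E (Un : set X * nat) : set Y :=
  \bigcup_(m in [set m | (Un.2 <= m)%N /\ M m `&` Un.1 !=set0]) N m.
have EP : ProperFilter (filter_from D E).
  apply: filter_from_proper.
    apply: filter_from_filter; first by exists (setT, 0%N); apply: filterT.
    move=> [U m] [U' m'] /= Ux U'x; exists (U `&` U', maxn m m').
      exact: filterI.
    move=> y [k [/=]]; rewrite geq_max => /andP[mk m'k] [z [Mz [Uz U'z]]] Ny.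
    by split; exists k => //; split=> //; exists z.
  move=> [U m] Ux; have [n mn MU] := Mx U m Ux.
  by have [y Ny] := N0 n; exists y, n.
have [n|y [By cy]] := frakV_k_cluster BK EP.
  exists (setT, n) => /=; first exact: filterT.
  by move=> y [m [/= nm _] /NB]; apply: frakV_le.
exists y => //; apply/upper_ltP => W n [[U U'] /= [Ux U'y] UW].
have [|z [[m [/= nm [a [Ma Ua]]] Nz] U'z]] := cy (E (U, n)) U' _ U'y.
  by exists (U, n).
by exists m => //; exists (a, z); split=> //; apply: UW.
Qed.

Lemma frakV_setX A B : frakV X A -> frakV Y B ->
  frakV (X * Y)%type (fun n => A n `*` B n).
Proof.
move=> AA BB n; have [oA [a Aa] sA] := AA n; have [oB [b Bb] sB] := BB n.
split; [exact: open_setX|by exists (a, b)|].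
by move=> [x y] [/sA ? /sB ?].
Qed.

Lemma frakV_p_setX A B : frakV_p X A -> frakV_k Y B ->
  frakV_p (X * Y)%type (fun n => A n `*` B n).
Proof.
move=> [AA Ap] BK; have [[BB _] _ _] := BK; split; first exact: frakV_setX.
move=> z zV; have [n _ ->|x [zx Ax]] := Ap (fun n => (z n).1).
  by have [] := zV n _ erefl.
have [n|n _ ->|y By zy] := upper_lt_setX (N := fun n => [set (z n).2]) BK _ _ zx.
- by exists (z n).2.
- by have [] := zV n _ erefl.
exists (x, y); rewrite bigcap_setX; split=> //.
by apply: upper_lt_sub zy => n [a b] [/= -> ->]; rewrite -surjective_pairing.
Qed.

Lemma frakV_o_setX A B : frakV_o X A -> frakV_k Y B ->
  frakV_o (X * Y)%type (fun n => A n `*` B n).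
Proof.
move=> [AA Ao] BK; have [[BB _] _ _] := BK; split; first exact: frakV_setX.
move=> M MV; have /choice [CD CDM] : forall n, exists CD : set X * set Y,
    [/\ open CD.1 /\ CD.1 !=set0, CD.2 !=set0 & CD.1 `*` CD.2 `<=` M n].
  move=> n; have [oM [[x y] Mxy] _] := MV n.
  have [C [D [[oC Cx] [oD Dy] CDM]]] := open_box oM Mxy.
  by exists (C, D); split=> //; [split=> //; exists x|exists y].
have [n|x [Cx Ax]] := Ao (fun n => (CD n).1).
  have [[oC C0] [d Dd] CDn] := CDM n; have [_ _ MVn] := MV n.
  by split=> // c Cc; have [] := MVn (c, d) (CDn (c, d) (conj Cc Dd)).
have [n|n d Dd|y By CDxy] := upper_lt_setX (N := fun n => (CD n).2) BK _ _ Cx.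
- by have [] := CDM n.
- have [[oC [c Cc]] _ CDn] := CDM n; have [_ _ MVn] := MV n.
  by have [] := MVn (c, d) (CDn (c, d) (conj Cc Dd)).
exists (x, y); rewrite bigcap_setX; split=> //.
by apply: upper_lt_sub CDxy => n; have [] := CDM n.
Qed.

(** Each note is a box inside beta's move; its sides are the moves of beta in the
    games on the two factors. *)
Lemma Gamma_setX r : (forall A B, frakV_ r X A -> frakV_k Y B ->
    frakV_ r (X * Y)%type (fun n => A n `*` B n)) ->
  Gamma_BM r X -> Gamma_BM BM_k Y -> Gamma_BM r (X * Y)%type.
Proof.
move=> rprod /alpha_winsP [u [u0 uL uW]] /alpha_winsP [v [v0 vL vW]].
apply/alpha_winsP.
pose out (ds : seq (set X * set Y)) := u (map fst ds) `*` v (map snd ds).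
apply: (@wins_from_notes _ _ _ _ (setT, setT) out
  (fun ds V d => [/\ legal_move d.1 (u (map fst ds)),
     legal_move d.2 (v (map snd ds)) & d.1 `*` d.2 `<=` V])).
- by rewrite /out /= u0 v0 setXTT.
- move=> ds V [oV [[x y] Vxy] VU].
  have [A [B [[oA Ax] [oB By] ABV]]] := open_box oV Vxy.
  have A0 : A !=set0 by exists x.
  have B0 : B !=set0 by exists y.
  exists (A, B); split; first split=> //=.
  + by split=> // a Aa; have [] := VU (a, y) (ABV (a, y) (conj Aa By)).
  + by split=> // b Bb; have [] := VU (x, b) (ABV (x, b) (conj Ax Bb)).
  + rewrite /out !map_rcons.
    have [ou [a ua] uA] := uL (map fst ds) A oA A0.
    have [ov [b vb] vB] := vL (map snd ds) B oB B0.
    split; [exact: open_setX|by exists (a, b)|].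
    by apply: subset_trans ABV => -[s t] [/uA ? /vB ?].
move=> V d VL dP.
have map1 n : map fst (mkseq d n) = mkseq (fst \o d) n by rewrite -map_comp.
have map2 n : map snd (mkseq d n) = mkseq (snd \o d) n by rewrite -map_comp.
have AL n : legal_move (d n).1 (u (mkseq (fst \o d) n)).
  by rewrite -map1; have [] := dP n.
have BL n : legal_move (d n).2 (v (mkseq (snd \o d) n)).
  by rewrite -map2; have [] := dP n.
have AA : frakV X (fst \o d) by apply: play_frakV AL.
have BB : frakV Y (snd \o d) by apply: play_frakV BL.
have ABV n : (d n).1 `*` (d n).2 `<=` V n by have [] := dP n.
have VAB n : V n.+1 `<=` (d n).1 `*` (d n).2.
  have [_ _ VU] := VL n.+1; apply: subset_trans VU _.
  rewrite /out map1 map2 !mkseqS => -[a b] [/=].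
  have [oA A0 _] := AL n; have [oB B0 _] := BL n.
  have [_ _ uA] := uL (mkseq (fst \o d) n) _ oA A0.
  have [_ _ vB] := vL (mkseq (snd \o d) n) _ oB B0.
  by move=> /uA ? /vB ?.
have VV : frakV _ V.
  move=> n; have [oV V0 _] := VL n; split=> //.
  exact: subset_trans (VAB n) (ABV n).
apply/alpha_targetP => // -[[x y] Vxy].
have Axy n : (d n).1 x /\ (d n).2 y := VAB n (x, y) (Vxy n.+1 I).
have [Ar|[_ []]] := uW _ AL; last by split=> //; exists x => n _; have [] := Axy n.
have [Bk|[_ []]] := vW _ BL; last by split=> //; exists y => n _; have [] := Axy n.
by apply: (frakV_interleave VV _ ABV VAB); apply: (rprod (fst \o d) (snd \o d)).
Qed.

End BinaryProduct.

(** * Countable products *)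
Section CountableProduct.

Lemma prod_cvg (I : Type) (Y : I -> topologicalType)
    (G : set_system (prod_topology Y)) (z : prod_topology Y) : Filter G ->
  (forall i, (fun t : prod_topology Y => t i) @ G --> z i) -> G --> z.
Proof.
move=> GF Gz; apply/cvg_sup => i U [_ [[W oW <-] /= Wz WU]].
apply: (filterS WU); apply: (Gz i W); exact: open_nbhs_nbhs.
Qed.

Variable X : nat -> topologicalType.
Local Notation PX := (prod_topology X).

Definition box (A : forall i, set (X i)) : set PX := [set z | forall i, A i (z i)].

Definition open_board (A : forall i, set (X i)) : Prop :=
  (forall i, open (A i)) /\ exists N, forall i, (N <= i)%N -> A i = setT.

Lemma box_open (A : forall i, set (X i)) : open_board A -> open (box A).
Proof.
move=> [oA [N AN]].
have boxE n : open [set z : PX | forall i, (i < n)%N -> A i (z i)].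
  elim: n => [|n IH].
    by rewrite (_ : [set _ | _] = setT); [exact: openT|apply/seteqP; split].
  rewrite (_ : [set _ | _] =
     [set z : PX | forall i, (i < n)%N -> A i (z i)] `&` proj n @^-1` A n).
    apply: openI => //; apply: open_comp (oA n) => z _; exact: proj_continuous.
  apply/seteqP; split=> z /=.
    by move=> H; split=> [i /ltnW|]; apply: H.
  by move=> [H Hn] i; rewrite ltnS leq_eqVlt => /orP[/eqP ->|] //; exact: H.
rewrite (_ : box A = [set z : PX | forall i, (i < N)%N -> A i (z i)]); first exact: boxE.
apply/seteqP; split=> z //= H i; by have [/AN ->|/H //] := leqP N i.
Qed.

(** The boxes around [z] generate a filter which converges to [z] coordinate by
    coordinate, hence in the product. *)
Lemma box_base (V : set PX) z : open V -> V z ->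
  exists A, [/\ open_board A, box A z & box A `<=` V].
Proof.
move=> oV Vz.
pose D := [set A : forall i, set (X i) | open_board A /\ box A z].
suff : filter_from D box V by move=> [A [bA Az] AV]; exists A.
have FF : Filter (filter_from D box).
  apply: filter_from_filter.
    by exists (fun=> setT); split=> //; split=> [i|]; [exact: openT|exists 0%N].
  move=> A B [[oA [M AM]] Az] [[oB [N BN]] Bz].
  exists (fun i => A i `&` B i).
    split; last by move=> i; split.
    split=> [i|]; first exact: openI.
    exists (maxn M N) => i; rewrite geq_max => /andP[/AM -> /BN ->].
    by rewrite setIT.
  by move=> t tAB; split=> i; have [] := tAB i.
suff : filter_from D box --> z by apply; apply: open_nbhs_nbhs.
apply: prod_cvg => i U /nbhs_interior Uz.
exists (dfwith (fun=> setT) i U°).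
  split; last by move=> j; case: dfwithP => //; apply: nbhs_singleton.
  split=> [j|]; first by case: dfwithP => *; [exact: open_interior|exact: openT].
  by exists i.+1 => j ij; rewrite dfwithout // neq_ltn ij.
by move=> t /(_ i); rewrite dfwithin => /interior_subset.
Qed.

Lemma ultra_fmap (S T : Type) (f : S -> T) (G : set_system S) :
  UltraFilter G -> UltraFilter (f @ G).
Proof.
move=> GU; split=> [|H HP GH].
  exact: fmap_proper_filter.
apply/seteqP; split=> // A HA; rewrite /fmap /=.
have [//|GnA] := in_ultra_setVsetC (f @^-1` A) GU.
have /filter_ex [x []//] : H (A `&` ~` A) by apply: filterI => //; apply: GH.
Qed.

Lemma box_subset (A B : forall i, set (X i)) : box A !=set0 ->
  box A `<=` box B -> forall i, A i `<=` B i.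
Proof.
move=> [z Az] AB i x Ax; rewrite -[x](dfwithin z x).
by apply: (AB (dfwith z i x)) => j; case: dfwithP.
Qed.

(** In a sequence of boxes [d n], factor [i] enters at round [i]: its own play is
    the shifted sequence [coord i]. *)
Section BoxSequence.
Variable d : nat -> forall i, set (X i).
Arguments d : clear implicits.
Let coord i j : set (X i) := d (i + j)%N i.
Arguments coord : clear implicits.

Hypothesis dV : frakV PX (fun n => box (d n)).

Lemma bigcap_box : \bigcap_n box (d n) =
  [set z : PX | forall i, (\bigcap_j coord i j) (z i)].
Proof.
apply/seteqP; split=> z; first by move=> H i j _; apply: H.
move=> H n _ i; have sub := frakV_le dV (leq_addl i n).
by apply: (box_subset _ sub); [have [] := dV (i + n)%N|apply: H].
Qed.

Lemma coord_filter (G : set_system PX) : Filter G -> (forall n, G (box (d n))) ->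
  forall i j, (proj i @ G) (coord i j).
Proof.
move=> GF Gd i j; suff : G [set z : PX | coord i j (z i)] by [].
by apply: filterS (Gd (i + j)%N) => z; apply.
Qed.

Lemma frakV_k_box : (forall i, frakV_k (X i) (coord i)) ->
  frakV_k PX (fun n => box (d n)).
Proof.
move=> dk.
have cap0 i : \bigcap_j coord i j !=set0 by have [[]] := dk i.
apply: frakV_kI => //.
  rewrite bigcap_box; exists (fun i => projT1 (cid (cap0 i))) => i.
  exact: projT2 (cid (cap0 i)).
move=> G GU Gd.
have cv i : exists x, (\bigcap_j coord i j) x /\ proj i @ G --> x.
  have [x ? ?] := frakV_k_cvg (dk i) (ultra_fmap (proj i) GU) (coord_filter _ Gd i).
  by exists x.
exists (fun i => projT1 (cid (cv i))).
  by rewrite bigcap_box => i; have [] := projT2 (cid (cv i)).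
by apply: prod_cvg => i; have [] := projT2 (cid (cv i)).
Qed.

Lemma frakV_f_box : (forall i, frakV_f (X i) (coord i)) ->
  frakV_f PX (fun n => box (d n)).
Proof.
move=> df.
have cv i : exists x, (\bigcap_j coord i j) x /\
    forall G, Filter G -> (forall j, G (coord i j)) -> G --> x.
  by have [x ? ?] := frakV_f_cvg (df i); exists x.
pose z : PX := fun i => projT1 (cid (cv i)).
apply: (@frakV_fI _ _ z) => // [|G GU Gd].
  by rewrite bigcap_box => i; have [] := projT2 (cid (cv i)).
apply: prod_cvg => i; have [_] := projT2 (cid (cv i)); apply.
exact: coord_filter.
Qed.

End BoxSequence.

Lemma drop_mkseq (T : Type) (f : nat -> T) i j :
  drop i (mkseq f (i + j)) = mkseq (fun k => f (i + k)%N) j.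
Proof.
rewrite /mkseq -map_drop drop_iota add0n addKn -[i in iota i]addn0 iotaDl.
by rewrite -map_comp.
Qed.

(** The notes are boxes.  Dropping the first [i] of them leaves the play on factor
    [i]; before round [i] nothing is left and the strategy [u i] answers with the
    whole factor, so the intersection with the last box leaves that coordinate as
    beta chose it.  Thus only finitely many coordinates are cut at each round. *)
Lemma Gamma_prod r :
  (forall d : nat -> forall i, set (X i), frakV PX (fun n => box (d n)) ->
    (forall i, frakV_ r (X i) (fun j => d (i + j)%N i)) ->
    frakV_ r PX (fun n => box (d n))) ->
  (forall i, Gamma_BM r (X i)) -> Gamma_BM r PX.
Proof.
move=> rbox XG; apply/alpha_winsP.
have uex i : exists u : seq (set (X i)) -> set (X i), [/\ u [::] = setT,
    forall vs V, open V -> V !=set0 -> legal_move (u (rcons vs V)) V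
    & forall V, (forall n, legal_move (V n) (u (mkseq V n))) ->
      alpha_target r (X i) V].
  by apply/alpha_winsP; apply: XG.
pose u i := projT1 (cid (uex i)).
have u0 i : u i [::] = setT by have [] := projT2 (cid (uex i)).
have uL i vs (V : set (X i)) :
    open V -> V !=set0 -> legal_move (u i (rcons vs V)) V.
  by have [_ + _] := projT2 (cid (uex i)); apply.
have uW i V : (forall n, legal_move (V n) (u i (mkseq V n))) ->
      alpha_target r (X i) V.
  by have [_ _] := projT2 (cid (uex i)); apply.
pose at_ i (ds : seq (forall i, set (X i))) := map (fun A => A i) ds.
pose reply ds i := u i (drop i (at_ i ds)) `&` last setT (at_ i ds).
have replyE ds A i : open (A i) -> A i !=set0 ->
    [/\ open (reply (rcons ds A) i), reply (rcons ds A) i !=set0,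
      reply (rcons ds A) i `<=` A i & (size ds < i)%N ->
      reply (rcons ds A) i = A i].
  move=> oA A0; rewrite /reply /at_ map_rcons last_rcons -/(at_ i ds).
  have sz : size (at_ i ds) = size ds by rewrite size_map.
  have [ids|dsi] := leqP i (size ds).
    rewrite drop_rcons ?sz //.
    have [oR R0 RA] := uL i (drop i (at_ i ds)) _ oA A0.
    by rewrite (setIidl RA).
  by rewrite drop_oversize ?size_rcons ?sz // u0 setTI; split.
apply: (@wins_from_notes _ _ _ _ (fun=> setT) (fun ds => box (reply ds))
  (fun ds V A => [/\ open_board A, box A !=set0 & box A `<=` V])).
- by apply/seteqP; split=> // z _ i; rewrite /reply /= u0; split.
- move=> ds V [oV [z Vz] _]; have [A [bA Az AV]] := box_base oV Vz.
  exists A; split; first by split=> //; exists z.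
  have A0 i : A i !=set0 by exists (z i).
  have [oA [N AN]] := bA.
  have R i := replyE ds A i (oA i) (A0 i).
  split.
  + apply: box_open; split=> [i|]; first by have [] := R i.
    exists (maxn N (size ds).+1) => i; rewrite geq_max => /andP[Ni dsi].
    by have [_ _ _ ->] := R i; rewrite ?AN.
  + have R0 i : reply (rcons ds A) i !=set0 by have [] := R i.
    by exists (fun i => projT1 (cid (R0 i))) => i; apply: projT2 (cid (R0 i)).
  + by apply: subset_trans AV => t tR i; have [_ _ + _] := R i; apply.
move=> V d VL dP.
have AV n : box (d n) `<=` V n by have [] := dP n.
have Vreply n : V n `<=` box (reply (mkseq d n)) by have [_ _] := VL n.
have VA n : V n.+1 `<=` box (d n).
  apply: subset_trans (Vreply n.+1) _ => z zR i; have [_] := zR i.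
  by rewrite mkseqS /at_ map_rcons last_rcons.
have VV : frakV _ V.
  by move=> n; have [? ? _] := VL n; split=> //; apply: subset_trans (VA n) (AV n).
have dV : frakV PX (fun n => box (d n)).
  move=> n; have [bA A0 _] := dP n; split=> //; first exact: box_open.
  exact: subset_trans (AV n.+1) (VA n).
apply/alpha_targetP => // -[z Vz].
apply: (frakV_interleave VV _ AV VA); apply: rbox => // i.
have [//|[_ []]] : alpha_target r (X i) (fun j => d (i + j)%N i).
  apply: uW => j; have [[oA _] A0 _] := dP (i + j)%N; split=> //.
    by have [t At] := A0; exists (t i).
  have /(box_subset A0)/(_ i) : box (d (i + j)%N) `<=` box (reply (mkseq d (i + j))).
    exact: subset_trans (AV _) (Vreply _).
  rewrite /reply /at_ /mkseq -map_comp => /subset_trans; apply => x [+ _].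
  by rewrite -[map _ _]/(mkseq _ _) drop_mkseq.
split; last by exists (z i) => j _; apply: (VA (i + j)%N); apply: Vz.
move=> j; have [[oA _] [t At] _] := dP (i + j)%N; split=> //; first by exists (t i).
rewrite addnS; apply: box_subset; first by have [] := dP (i + j).+1.
by have [] := dV (i + j)%N.
Qed.

End CountableProduct.

(** * Open subspaces and the local property *)
Section Injection.
Variables (Y X : topologicalType) (j : Y -> X).
Hypotheses (j_inj : injective j) (j_cont : continuous j).
Implicit Types (d : nat -> set Y) (x : X) (y : Y).

Lemma bigcap_image d : \bigcap_n (j @` d n) = j @` \bigcap_n d n.
Proof.
apply/seteqP; split=> [x H|_ [y dy <-] n _]; last by exists y => //; apply: dy.
have [y _ yx] := H 0%N I; exists y => // n _.
by have [z dz] := H n I; rewrite -yx => /j_inj <-.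
Qed.

Lemma upper_lt_image d y : upper_lt d y -> upper_lt (fun n => j @` d n) (j y).
Proof.
move=> /upper_ltP dy; apply/upper_ltP => U N Uy.
have [n Nn [z [dz Uz]]] := dy (j @^-1` U) N (j_cont Uy).
by exists n => //; exists (j z); split=> //; exists z.
Qed.

Lemma frakV_image_of r d : frakV X (fun n => j @` d n) ->
  frakV_ r Y d -> frakV_ r X (fun n => j @` d n).
Proof.
move=> XX; have im0 : \bigcap_n d n !=set0 -> \bigcap_n (j @` d n) !=set0.
  by move=> [y dy]; rewrite bigcap_image; exists (j y); exists y.
case: r => /=.
- move=> [[dd d0] [y dy [_ dU]]]; split; first by split=> //; apply: im0.
  exists (j y); first by rewrite bigcap_image; exists y.
  split=> [n|U /j_cont/dU [n dnU]].
    by split; [have [] := XX n|exists y => //; apply: dy].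
  by exists n => _ [z /dnU ? <-].
- move=> [[dd d0] dc [_ dW]]; split; first by split=> //; apply: im0.
    by rewrite bigcap_image; apply: continuous_compact dc; apply: continuous_subspaceT.
  split=> [n|W oW]; first by split; [have [] := XX n|move=> x; apply].
  rewrite bigcap_image => dsW; have [|y dy|n dnW] := dW (j @^-1` W).
  + by apply: open_comp oW => ? _; apply: j_cont.
  + by apply: dsW; exists y.
  + by exists n => _ [z /dnW ? <-].
- move=> [dd dp]; split=> // x xd.
  have /choice [y yP] : forall n, exists y, d n y /\ j y = x n.
    by move=> n; have [z ? ?] := xd n _ erefl; exists z.
  have [n _ ->|z [yz dz]] := dp y; first by have [] := yP n.
  exists (j z); rewrite bigcap_image; split; last by exists z.
  by apply: upper_lt_sub (upper_lt_image yz) => n _ [_ -> <-]; have [_ ->] := yP n.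
- move=> [dd dp]; split=> // M MP.
  have [n|y [My dy]] := dp (fun n => j @^-1` M n).
    have [oM [x Mx] Md] := MP n; split.
    + by apply: open_comp oM => ? _; apply: j_cont.
    + by have [y _ yx] := Md x Mx; exists y; rewrite /= yx.
    + by move=> y /Md [z dz /j_inj <-].
  exists (j y); rewrite bigcap_image; split; last by exists y.
  by apply: upper_lt_sub (upper_lt_image My) => n _ [z Mz <-].
Qed.

Hypothesis j_open : forall A : set Y, open A -> open (j @` A).

Lemma nbhs_image y U : nbhs y U -> nbhs (j y) (j @` U).
Proof.
rewrite nbhsE => -[W [oW Wy] WU]; apply: (@filterS _ _ _ (j @` W)).
  exact: image_subset.
by apply: open_nbhs_nbhs; split; [exact: j_open|exists y].
Qed.

Lemma upper_lt_preimage d y : upper_lt (fun n => j @` d n) (j y) -> upper_lt d y.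
Proof.
move=> /upper_ltP dy; apply/upper_ltP => U N /nbhs_image Uy.
have [n Nn [_ [[z dz <-] [t Ut /j_inj tz]]]] := dy _ N Uy.
by exists n => //; exists z; split=> //; rewrite -tz.
Qed.

Lemma image_subset_inj (A B : set Y) : j @` A `<=` j @` B -> A `<=` B.
Proof. by move=> AB y Ay; have [|z Bz /j_inj <-] := AB (j y); first by exists y. Qed.

Lemma frakV_image d : frakV X (fun n => j @` d n) <-> frakV Y d.
Proof.
split=> H n; have [oA A0 AS] := H n.
  split; last exact: image_subset_inj AS.
    rewrite (_ : d n = j @^-1` (j @` d n)).
      by apply: open_comp oA => ? _; apply: j_cont.
    by apply/seteqP; split=> [y dy|y [z dz /j_inj <-]] //; exists y.
  by have [_ [y dy _]] := A0; exists y.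
split; [exact: j_open| |exact: image_subset].
by have [y dy] := A0; exists (j y), y.
Qed.

Lemma frakV_of_image r d :
  frakV_ r X (fun n => j @` d n) -> frakV_ r Y d.
Proof.
have im0 : \bigcap_n (j @` d n) !=set0 -> \bigcap_n d n !=set0.
  by rewrite bigcap_image => -[_ [y dy _]]; exists y.
case: r => /=.
- move=> [[/frakV_image dd d0] [x]]; rewrite bigcap_image => -[y dy <-] [_ dU].
  split; first by split=> //; apply: im0.
  exists y => //; split=> [n|U /nbhs_image/dU [n dnU]].
    by split; [have [] := dd n|apply: dy].
  by exists n; apply: image_subset_inj.
- move=> [[/frakV_image dd d0]]; rewrite bigcap_image => dc [_ dW].
  split; first by split=> //; apply: im0.
    move=> G GP Gd.
    have jG A : G A -> (j @ G) (j @` A).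
      by rewrite nbhs_simpl /=; apply: filterS => y Ay; exists y.
    have [_ [[y dy <-] cy]] := dc (j @ G) _ (jG _ Gd).
    exists y; split=> // A B GA /nbhs_image By.
    have [_ [[a Aa <-] [b Bb /j_inj ba]]] := cy (j @` A) _ (jG _ GA) By.
    by exists a; split=> //; rewrite -ba.
  split=> [n|W oW dsW]; first by split; [have [] := dd n|move=> y; apply].
  have [||n dnW] := dW (j @` W); [exact: j_open|exact: image_subset|].
  by exists n; apply: image_subset_inj.
- move=> [/frakV_image dd dp]; split=> // y yd.
  have [n _ ->|x] := dp (fun n => j (y n)); first by exists (y n) => //; apply: yd.
  rewrite bigcap_image => -[yx [z dz zx]]; exists z; split=> //.
  apply: upper_lt_preimage; rewrite zx.
  by apply: upper_lt_sub yx => n _ ->; exists (y n).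
- move=> [/frakV_image dd dp]; split=> // M MP.
  have [n|x] := dp (fun n => j @` M n).
    have [oM [y My] Md] := MP n; split; [exact: j_open| |exact: image_subset].
    by exists (j y), y.
  rewrite bigcap_image => -[Mx [z dz zx]]; exists z; split=> //.
  by apply: upper_lt_preimage; rewrite zx.
Qed.

End Injection.

Section Subspace.
Variables (X : topologicalType) (U : set X).
Local Notation j := (@set_val X U).

Lemma set_val_cont : continuous j.
Proof. exact: initial_continuous. Qed.

Lemma set_val_image (B : set X) : j @` (j @^-1` B) = B `&` U.
Proof.
apply/seteqP; split=> [_ [y By <-]|x [Bx Ux]]; first by split=> //; apply: set_valP.
by exists (SigSub (mem_set Ux)).
Qed.

Lemma set_val_open (A : set (set_type U)) (O : set X) :
  open O -> O `<=` U -> j @` A `<=` O -> open A -> open (j @` A).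
Proof.
move=> oO OU AO [B oB BA].
rewrite (_ : j @` A = B `&` O); first exact: openI.
rewrite -BA in AO *; move: AO; rewrite set_val_image => AO.
apply/seteqP; split=> x [Bx Ox]; split=> //; [exact: AO|exact: OU].
Qed.

Lemma Gamma_open_sub r : Gamma_BM r X -> open U -> Gamma_BM r (set_type U).
Proof.
move=> /alpha_winsP [u [u0 uL uW]] oU; apply/alpha_winsP.
have jo A : open A -> open (j @` A).
  apply: (set_val_open oU) => // _ [y _ <-]; exact: set_valP.
have jinj : injective j by exact: val_inj.
apply: (@wins_from_notes _ _ _ _ setT (fun ds => j @^-1` u ds)
   (fun ds V d => d = j @` V)).
- by rewrite u0.
- move=> ds V [oV [y Vy] VU]; exists (j @` V); split=> //.
  have [|ou [x ux] uV] := uL ds (j @` V) (jo _ oV); first by exists (j y), y.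
  split.
  + by apply: open_comp ou => ? _; apply: set_val_cont.
  + by have [z _ zx] := uV x ux; exists z; rewrite /= zx.
  + by move=> z /uV [t Vt /jinj <-].
move=> V d VL dE; have dL n : legal_move (d n) (u (mkseq d n)).
  rewrite dE; have [oV [y Vy] Vu] := VL n; split; [exact: jo|by exists (j y), y|].
  by move=> _ [z /Vu ? <-].
have dV := play_frakV uL dL.
have dE' : d = fun n => j @` V n by apply/funext.
rewrite dE' in dV; apply/alpha_targetP.
  by apply/(frakV_image jinj set_val_cont jo).
move=> [y Vy]; have := uW _ dL; rewrite dE' => -[|[_ []]].
  exact: (frakV_of_image jinj set_val_cont jo).
by split=> //; exists (j y); rewrite (bigcap_image jinj); exists y.
Qed.

(** The notes are the traces on [U] of beta's moves; alpha's answers are open in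
    the whole space because they are open in [U] and lie in [O].  Intersecting the territory with [O] keeps beta's moves inside [O] and
    gives [O] itself as the initial territory. *)
Lemma wins_from_in_subspace r (O : set X) : Gamma_BM r (set_type U) ->
  open O -> O `<=` U -> O !=set0 -> wins_from O (alpha_target r X).
Proof.
move=> /alpha_winsP [u [u0 uL uW]] oO OU O0.
have jinj : injective j by exact: val_inj.
pose out ds := O `&` j @` u ds.
apply: (@wins_from_notes _ _ _ _ setT out
   (fun ds V d => open d /\ j @` d = V)).
- rewrite /out u0; apply/setIidl; apply: subset_trans OU _ => x Ux.
  by exists (SigSub (mem_set Ux)).
- move=> ds V [oV [x Vx] VU]; exists (j @^-1` V).
  have VO : V `<=` O by move=> y /VU [].
  have jV : j @` (j @^-1` V) = V.
    by rewrite set_val_image; apply/setIidl; apply: subset_trans VO OU.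
  have odV : open (j @^-1` V) by apply: open_comp oV => ? _; apply: set_val_cont.
  split=> //; have [|ou [y uy] uV] := uL ds _ odV.
    by have [y Vy _] : (j @` (j @^-1` V)) x by [rewrite jV]; exists y.
  have uV' : j @` u (rcons ds (j @^-1` V)) `<=` V by rewrite -{2}jV; apply: image_subset.
  split.
  + apply: openI => //; apply: (set_val_open oV) => //.
    exact: subset_trans VO OU.
  + by exists (j y); split; [apply/VO/uV'|]; exists y.
  + by move=> z [_ /uV'].
move=> V d VL dP; have dL n : legal_move (d n) (u (mkseq d n)).
  have [oV [x Vx] Vu] := VL n; have [od dV] := dP n; split=> //.
    by move: Vx; rewrite -dV => -[y dy _]; exists y.
  by apply: (image_subset_inj jinj); rewrite dV => y /Vu [].
have VE : V = fun n => j @` d n by apply/funext => n; have [_ ->] := dP n.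
have dd := play_frakV uL dL.
have VV : frakV X (fun n => j @` d n).
  move=> n; have [_ [y dy] dS] := dd n; have [oV _ _] := VL n.
  by split; [have [_ ->] := dP n|exists (j y), y|exact: image_subset].
rewrite VE; apply/alpha_targetP => // -[x]; rewrite (bigcap_image jinj) => -[y dy _].
have [dr|[_ []]] := uW _ dL; first exact: (frakV_image_of jinj set_val_cont).
by split=> //; exists y.
Qed.

End Subspace.

(** The first note holds a strategy on a small open part of beta's first move, the
    later ones hold the moves of beta in that game.  The first move of beta lies
    outside that game, hence the shift by one. *)
Lemma Gamma_locally r (X : topologicalType) : locally_Gamma_BM r X -> Gamma_BM r X.
Proof.
move=> lG; apply/alpha_winsP.
pose total (u : seq (set X) -> set X) :=
  forall vs V, open V -> V !=set0 -> legal_move (u (rcons vs V)) V.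
(* Repeating beta's last move: a default that only makes the notes inhabited. *)
have total_last : total (last setT) by move=> vs V oV V0; rewrite last_rcons; split.
pose D := ({u | total u} * set X)%type.
pose out (ds : seq D) :=
  if ds is d :: ds' then proj1_sig d.1 (map snd ds') else setT.
pose P (ds : seq D) V (d : D) := if ds is [::] then
    proj1_sig d.1 [::] `<=` V /\
    forall W, (forall n, legal_move (W n) (proj1_sig d.1 (mkseq W n))) ->
      alpha_target r X W
  else d.2 = V.
apply: (@wins_from_notes _ _ _ _ (exist _ _ total_last, setT) out P) => //.
  case=> [|d ds] V [oV [x Vx] VU]; last first.
    exists (d.1, V); split=> //; rewrite /out /= map_rcons.
    by apply: (proj2_sig d.1) => //; exists x.
  have [U Ux UG] := lG x.
  have oO : open (V `&` U°) by apply: openI => //; exact: open_interior.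
  have O0 : V `&` U° !=set0 by exists x.
  have [|u [u0 uL uW]] := wins_from_in_subspace UG oO _ O0.
    by move=> y [_ /interior_subset].
  exists (exist _ u uL, setT); rewrite /P /= u0.
  by do 2?split=> //; move=> y [].
move=> V d VL dP; have [d0V d0W] := dP 0%N.
set u := proj1_sig (d 0%N).1 in d0V d0W.
have dS n : (d n.+1).2 = V n.+1 by have := dP n.+1.
have outS n : out (mkseq d n.+1) = u (mkseq (fun n => V n.+1) n).
  rewrite /out /= -map_comp -[1%N]addn0 iotaDl -map_comp; congr u.
  by apply: eq_map => k /=; rewrite add1n dS.
have SL n : legal_move (V n.+1) (u (mkseq (fun n => V n.+1) n)).
  by rewrite -outS.
have SV := play_frakV (proj2_sig (d 0%N).1) SL.
have V10 : V 1%N `<=` V 0%N by have [_ _] := SL 0%N; move/subset_trans; apply.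
have VS n : V n.+1 `<=` V n.
  by case: n => [//|n]; have [_ _] := SV n.
have VV : frakV X V by move=> n; have [oV V0 _] := VL n; split.
apply/alpha_targetP => // -[x Vx].
have [Sr|[_ []]] := d0W _ SL.
  apply: (frakV_interleave VV Sr) => n; first exact: VS.
  exact: subset_refl.
by split=> //; exists x => n _; apply: Vx.
Qed.

(** * Spaces with covers or networks *)
Lemma legal_move_interior X (V U : set X) x : open V -> nbhs x U -> V x ->
  legal_move (V `&` U°) V.
Proof.
move=> oV Ux Vx; split; first by apply: openI => //; exact: open_interior.
  by exists x.
exact: subIsetl.
Qed.

Lemma legal_move_in_cover X (G : set (set X)) V : open_cover G -> open V -> V !=set0 ->
  exists U, legal_move U V /\ exists2 A, G A & U `<=` A.
Proof.
move=> [oG Gcov] oV [x Vx]; have [A GA Ax] : (\bigcup_(A in G) A) x by rewrite Gcov.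
exists (V `&` A°); split.
  by apply: (legal_move_interior oV _ Vx); apply: open_nbhs_nbhs; split=> //; apply: oG.
by exists A => // y [_ /interior_subset].
Qed.

Lemma developable_Gamma_f X : developable X -> Gamma_BM BM_f X.
Proof.
move=> [G Gcov Gbase].
apply: (@Gamma_by_goals _ _ (fun n _ U => exists2 A, G n A & U `<=` A)).
- by move=> n _ A B AB [C GC BC]; exists C => //; apply: subset_trans BC.
- by move=> n V; apply: legal_move_in_cover.
move=> V VV [x Vx] VG; apply: (@frakV_fI _ _ x) => // F FU FV U.
have [_ xU] := Gbase x; move=> /xU [n nU]; apply: filterS (FV n.+1).
have [A GA VA] := VG n; move=> y /VA Ay; apply: nU; exists A => //.
by split=> //; apply/VA/Vx.
Qed.

Lemma metrizable_developable (R : realType) X : metrizable X R -> developable X.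
Proof.
move=> [M [f [g [fK gK fc gc]]]].
pose small n (A : set X) := open A /\ exists y, f @` A `<=` ball y (n.+1%:R^-1 : R)%R.
have bE n (y : M) : nbhs y (ball y (n.+1%:R^-1 : R)%R).
  by apply: nbhsx_ballx; rewrite invr_gt0 ltr0n.
have cov n : open_cover (small n).
  split=> [A [] //|]; apply/seteqP; split=> // x _.
  exists (f @^-1` (ball (f x) (n.+1%:R^-1 : R)%R)°).
    split; last by exists (f x) => _ [y /interior_subset Ay <-].
    by apply: open_comp (open_interior _) => ? _; apply: fc.
  exact: bE.
exists small => // x; split=> [n|U Ux].
  split; first by apply: bigcup_open => A [[]].
  have : (\bigcup_(A in small n) A) x by have [_ ->] := cov n.
  by move=> [A nA Ax]; exists A.
have : nbhs (f x) (g @^-1` U) by apply: gc; rewrite fK.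
rewrite -nbhs_ballE => -[e /= e0 eU].
have [n ne] : exists n, (n.+1%:R^-1 < e / 2)%R.
  have [n _ /(_ n (leqnn n)) ne] :=
    near_infty_natSinv_lt (PosNum (divr_gt0 e0 (ltr0Sn R 1))).
  by exists n.
exists n => z [A [[oA [y Ay]] Ax] Az].
rewrite -[z]fK; apply: eU.
have fx : ball y (n.+1%:R^-1)%R (f x) by apply: Ay; exists x.
have fz : ball y (n.+1%:R^-1)%R (f z) by apply: Ay; exists z.
have := ball_triangle (ball_sym fx) fz; apply: le_ball.
by rewrite [leRHS]splitr lerD // ltW.
Qed.

(** [U] lies on one side of each member of [F], the members being taken up to
    closure so that an open set in which [A] is dense counts as part of [A]. *)
Definition decides X (F : set (set X)) (U : set X) : Prop :=
  forall A, F A -> U `<=` closure A \/ U `&` A = set0.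

(** If [U] is not inside the closure of [A], removing this closure from [U] leaves
    a nonempty open set disjoint from [A]. *)
Lemma decides_seq X (s : seq (set X)) V : open V -> V !=set0 ->
  exists U, legal_move U V /\ decides [set` s] U.
Proof.
move=> oV V0; elim: s => [|A s [U [[oU U0 UV] Us]]].
  by exists V; split=> //; split=> //; exact: subset_refl.
have [UA|/existsNP [x /not_implyP [Ux nAx]]] := pselect (U `<=` closure A).
  by exists U; split=> // B /=; rewrite inE => /orP[/eqP ->|/Us //]; left.
exists (U `&` ~` closure A); split.
  split; last by move=> y [/UV].
    by apply: openI => //; rewrite openC; exact: closed_closure.
  by exists x.
move=> B /=; rewrite inE => /orP[/eqP ->|/Us [UB|UB]].
- right; apply/seteqP; split=> // y [[_ nAy] Ay]; apply: nAy.
  exact: subset_closure.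
- by left=> y [/UB].
- by right; apply/seteqP; split=> // y [[Uy _] By]; rewrite -UB.
Qed.

Lemma decides_subset X (F : set (set X)) (A B : set X) :
  A `<=` B -> decides F B -> decides F A.
Proof.
move=> AB FB C /FB [BC|BC]; [by left; apply: subset_trans BC|right].
by apply/seteqP; split=> // x [/AB Bx Cx]; rewrite -BC.
Qed.

Lemma locally_finite_decides X (F : set (set X)) V : locally_finite F ->
  open V -> V !=set0 -> exists U, legal_move U V /\ decides F U.
Proof.
move=> Ffin oV [x Vx]; have [U Ux /finite_seqP [s sE]] := Ffin x.
have [oW W0 WV] := legal_move_interior oV Ux Vx.
have [W [[oW' W'0 WW] Ws]] := decides_seq s oW W0.
exists W; split; first by split=> //; apply: subset_trans WV.
move=> A FA; have [AU|AU] := pselect (A `&` U !=set0).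
  by apply: Ws; rewrite -sE.
right; apply/seteqP; split=> // y [/WW [_ /interior_subset Uy] Ay].
by apply: AU; exists y.
Qed.

Lemma discrete_locally_finite X (F : set (set X)) :
  discrete_family F -> locally_finite F.
Proof.
move=> Fd x; have [U Ux UF] := Fd x; exists U => //.
have [[A [FA AU]]|nA] := pselect (exists A, F A /\ A `&` U !=set0).
  apply: (sub_finite_set _ (finite_set1 A)) => B [FB BU] /=; exact: UF.
by apply: (sub_finite_set _ (@finite_set0 _)) => B ?; apply: nA; exists B.
Qed.

(** Around [x] take a member [A] of the network inside a regular open [W].  A move
    that is decided and contains [x] lies in the closure of [A], hence in the
    interior of the closure of [W], which is [W]. *)
Lemma semiregular_sigma_Gamma_f X : semiregular X -> sigma_space X ->
  Gamma_BM BM_f X.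
Proof.
move=> [B [oB Bbase] Breg] [N Nfin Nnet].
apply: (@Gamma_by_goals _ _ (fun n _ U => decides (N n) U)).
- by move=> n _; apply: decides_subset.
- by move=> n V; apply: locally_finite_decides.
move=> V VV [x Vx] VN; apply: (@frakV_fI _ _ x) => // F FU FV U.
move=> /Bbase [W [BW Wx] WU]; apply: (filterS WU).
have [S SN WS] := Nnet W (oB _ BW).
have [A SA Ax] : (\bigcup_(A in S) A) x by rewrite -WS.
have [n _ NA] := SN A SA.
have VA : V n.+1 `<=` closure A.
  have [//|VA0] := VN n A NA.
  by have : (V n.+1 `&` A) x; [split=> //; apply: Vx|rewrite VA0].
apply: filterS (FV n.+1); rewrite -(Breg W BW).
have [oV _ _] := VV n.+1; rewrite -open_subsetE //.
apply: subset_trans VA _; apply: closureS; rewrite WS => y Ay.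
by exists A.
Qed.

(** Singletons indexed by an injection into the natural numbers are locally
    finite families. *)
Lemma countable_network_sigma X : has_countable_network X -> sigma_space X.
Proof.
move=> [N /countable_injP [f finj] Nnet].
exists (fun n => [set A | N A /\ f A = n]); last first.
  rewrite (_ : \bigcup_n _ = N) //; apply/seteqP; split=> [A [n _ []] //|A NA].
  by exists (f A).
move=> n x; exists setT; first exact: filterT.
have [[A [NA fA]]|nA] := pselect (exists A, N A /\ f A = n).
  apply: (sub_finite_set _ (finite_set1 A)) => B [[NB fB] _] /=.
  by apply: finj; rewrite ?inE // fA.
by apply: (sub_finite_set _ (@finite_set0 _)) => B [NB _]; apply: nA; exists B.
Qed.

(** * Quasi-regular spaces *)
(** The move is shrunk twice: first to a set with closure inside beta's move, then
    to reach the goal [Q n]. *)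
Lemma closure_goals r X (Q : nat -> set X -> Prop) : quasi_regular X ->
  (forall n A B, A `<=` B -> Q n B -> Q n A) ->
  (forall n V, open V -> V !=set0 -> exists U, legal_move U V /\ Q n U) ->
  (forall V, frakV X V -> \bigcap_n V n !=set0 ->
    (forall n, closure (V n.+1) `<=` V n) -> (forall n, Q n (V n.+1)) ->
    frakV_ r X V) ->
  Gamma_BM r X.
Proof.
move=> Xqr Qanti Qex QV.
apply: (@Gamma_by_goals _ _ (fun n V U => closure U `<=` V /\ Q n U)).
- move=> n V A B AB [BV QB]; split; last exact: Qanti QB.
  exact: subset_trans (closureS AB) BV.
- move=> n V oV V0; have [W [oW W0 WV]] := Xqr V oV V0.
  have [U [[oU U0 UW] QU]] := Qex n W oW W0.
  have UV : closure U `<=` V by apply: subset_trans (closureS UW) WV.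
  exists U; split=> //; split=> //; apply: subset_trans UV; exact: subset_closure.
by move=> V VV V0 VP; apply: QV => // n; have [] := VP n.
Qed.

Lemma cluster_bigcap X (V : nat -> set X) (G : set_system X) :
  (forall n, closure (V n.+1) `<=` V n) -> (forall n, G (V n)) ->
  cluster G `<=` \bigcap_n V n.
Proof. by move=> cV GV x; rewrite clusterE => Gx n _; apply/cV/Gx. Qed.

Lemma frakV_k_closure X (V : nat -> set X) : frakV X V ->
  \bigcap_n V n !=set0 -> (forall n, closure (V n.+1) `<=` V n) ->
  (forall G, UltraFilter G -> (forall n, G (V n)) -> exists x : X, G --> x) ->
  frakV_k X V.
Proof.
move=> VV V0 cV VG; apply: frakV_kI => // G GU GV.
have [x Gx] := VG G GU GV; exists x => //.
by apply: (cluster_bigcap cV GV); rewrite ultra_cvg_clusterE.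
Qed.

Lemma upper_lt_bigcap X (V M : nat -> set X) : frakV X V ->
  (forall n, closure (V n.+1) `<=` V n) -> (forall n, M n `<=` V n) ->
  upper_lt M `<=` \bigcap_n V n.
Proof.
move=> VV cV MV x /upper_ltP Mx n _; apply: cV => U /Mx.
move=> /(_ n.+1) [m nm [z [Mz Uz]]]; exists z; split=> //.
exact: (frakV_le VV nm) (MV _ _ Mz).
Qed.

Lemma frakV_p_closure X (V : nat -> set X) : frakV X V ->
  (forall n, closure (V n.+1) `<=` V n) ->
  (forall y : nat -> X, (forall n, V n (y n)) ->
    upper_lt (fun n => [set y n]) !=set0) -> frakV_p X V.
Proof.
move=> VV cV Vy; split=> // y yV; have [n|x yx] := Vy y; first exact: yV.
by exists x; split=> //; apply: (upper_lt_bigcap VV cV yV).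
Qed.

Lemma compact_Gamma_k X : quasi_regular X -> compact [set: X] -> Gamma_BM BM_k X.
Proof.
move=> Xqr Xc; apply: (@closure_goals _ _ (fun _ _ => True)) => //.
  by move=> _ V oV V0; exists V; split=> //; split=> //; exact: subset_refl.
move=> V VV V0 cV _; apply: frakV_k_closure => // G GU _.
move: Xc; rewrite compact_ultra => /(_ G GU filterT) [x [_ ?]]; by exists x.
Qed.

(** Without a cluster point in [K], the complements of the closures of the tails
    of [y] are an increasing open cover of [K], so one of them contains [K] and
    eventually contains [y], against its definition. *)
Lemma countably_compact_upper_lt X (K : set X) (y : nat -> X) :
  countably_compact K ->
  (forall W, open W -> K `<=` W -> exists N, forall n, (N <= n)%N -> W (y n)) ->
  K `&` upper_lt (fun n => [set y n]) !=set0.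
Proof.
move=> Kc yK; apply: contrapT => noK.
pose T n := [set y m | m in [set m | (n <= m)%N]].
pose W n := ~` closure (T n).
have oW n : open (W n) by rewrite openC; exact: closed_closure.
have WS m n : (m <= n)%N -> W m `<=` W n.
  move=> mn; apply: subsetC; apply: closureS => _ [i /= ni <-].
  by exists i => //=; apply: leq_trans ni.
have [x Kx|D /finite_seqP [s ->] KD] := Kc W oW.
  apply: contrapT => nW; apply: noK; exists x; split=> //.
  apply/upper_ltP => U N Ux; have /(_ U Ux) : closure (T N) x.
    by apply: contrapT => ?; apply: nW; exists N.
  by move=> [_ [[n /= Nn <-] Uy]]; exists n => //; exists (y n).
have KW : K `<=` W (\max_(i <- s) i).
  by move=> x /KD [n /= ns]; apply: WS; apply: (@leq_bigmax_seq _ s xpredT id n ns).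
have [N NW] := yK _ (oW _) KW.
apply: (NW (maxn N (\max_(i <- s) i))); first exact: leq_maxl.
apply: subset_closure; exists (maxn N (\max_(i <- s) i)) => //=.
exact: leq_maxr.
Qed.

Lemma countably_compact_Gamma_p X : quasi_regular X ->
  countably_compact [set: X] -> Gamma_BM BM_p X.
Proof.
move=> Xqr Xc; apply: (@closure_goals _ _ (fun _ _ => True)) => //.
  by move=> _ V oV V0; exists V; split=> //; split=> //; exact: subset_refl.
move=> V VV _ cV _; apply: frakV_p_closure => // y _.
have [|z [_ yz]] := @countably_compact_upper_lt _ _ y Xc; last by exists z.
by move=> W _ TW; exists 0%N => n _; apply: TW.
Qed.

Lemma wDelta_Gamma_p X : quasi_regular X -> wDelta_space X -> Gamma_BM BM_p X.
Proof.
move=> Xqr [G Gcov Gy].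
apply: (@closure_goals _ _ (fun n U => exists2 A, G n A & U `<=` A)) => //.
- by move=> n A B AB [C GC BC]; exists C => //; apply: subset_trans BC.
- by move=> n V; apply: legal_move_in_cover.
move=> V VV [x Vx] cV VG; apply: frakV_p_closure => // y yV.
have [n|z yz] := Gy x (fun n => y n.+1).
  have [A GA VA] := VG n; exists A; last exact/VA/yV.
  by split=> //; apply/VA/Vx.
exists z; apply: (@upper_lt_shift _ (fun n => [set y n])); apply/upper_ltP => U N Uz.
have [|_ [[n Nn <-] Uy]] :=
    yz [set y n.+1 | n in [set n | (N <= n)%N]] U _ Uz.
  by exists N => // n /= Nn; exists n.
by exists n => //; exists (y n.+1).
Qed.

(** Choose [C] through a point of the intersection.  Any open [W] around [C]
    contains a closed [A] of the family with [C] inside [A]; the move that decides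
    [A] meets [A], hence lies inside it.  So every open set around [C] contains
    some move, even though [C] may stick out of their intersection. *)
Lemma Sigma_space_Gamma r X (K : set X -> Prop) : quasi_regular X ->
  Sigma_space_for K ->
  (forall V C, frakV X V -> (forall n, closure (V n.+1) `<=` V n) ->
    \bigcap_n V n !=set0 -> K C ->
    (forall W, open W -> C `<=` W -> exists n, V n `<=` W) -> frakV_ r X V) ->
  Gamma_BM r X.
Proof.
move=> Xqr [F [C [[[D Dd FD] Fcl] Ccov CK FC]]] HV.
apply: (@closure_goals _ _ (fun n U => decides (D n) U)) => //.
- by move=> n; apply: decides_subset.
- by move=> n V; apply/locally_finite_decides/discrete_locally_finite.
move=> V VV V0 cV VD; have [x Vx] := V0.
have [L CL Lx] : (\bigcup_(L in C) L) x by rewrite Ccov.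
apply: (HV V L) => //; first by have [] := CK L CL.
move=> W oW LW; have [A FA [LA AW]] := FC L W CL oW LW.
have /closure_id Acl := Fcl A FA.
move: FA; rewrite FD => -[n _ DA]; exists n.+1.
have [|VA0] := VD n A DA; first by rewrite -Acl => /subset_trans; apply.
by have : (V n.+1 `&` A) x; [split; [apply: Vx|apply: LA]|rewrite VA0].
Qed.

Lemma strong_Sigma_space_Gamma_k X : quasi_regular X -> strong_Sigma_space X ->
  Gamma_BM BM_k X.
Proof.
move=> Xqr XS; apply: (Sigma_space_Gamma Xqr XS) => V C VV cV V0 Cc VC.
apply: frakV_k_closure => // G GU GV.
have [|x [_]] := compact_outer_cluster Cc _ (G := G).
  by move=> W oW /(VC W oW) [n Vn]; apply: filterS (GV n).
by rewrite ultra_cvg_clusterE; exists x.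
Qed.

Lemma Sigma_space_Gamma_p X : quasi_regular X -> Sigma_space X -> Gamma_BM BM_p X.
Proof.
move=> Xqr XS; apply: (Sigma_space_Gamma Xqr XS) => V C VV cV V0 Cc VC.
apply: frakV_p_closure => // y yV.
have [|x [_ yx]] := countably_compact_upper_lt (y := y) Cc; last by exists x.
move=> W oW /(VC W oW) [n Vn]; exists n => m nm.
exact/Vn/(frakV_le VV nm)/yV.
Qed.

(** Feeble compactness speaks of a set of open sets, not of a sequence: if the
    [M n] accumulate nowhere then their range is locally finite, hence finite, and
    some value taken infinitely often accumulates at each of its points. *)
Lemma feebly_compact_upper_lt X (M : nat -> set X) : feebly_compact X ->
  (forall n, open (M n)) -> (forall n, M n !=set0) -> upper_lt M !=set0.
Proof.
move=> Xf oM M0; apply: contrapT => noM.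
have Mfin (x : X) : exists2 U, nbhs x U &
    exists N, forall n, (N <= n)%N -> M n `&` U = set0.
  apply: contrapT => H; apply: noM; exists x; apply/upper_ltP => U N Ux.
  apply: contrapT => K; apply: H; exists U => //; exists N => n Nn.
  by apply/eqP; rewrite -[_ == _]negbK; apply/negP => /set0P MU; apply: K; exists n.
have rfin : finite_set (range M).
  apply: Xf => [_ [n _ <-] //|x]; have [U Ux [N NU]] := Mfin x; exists U => //.
  apply: (sub_finite_set _ (finite_image M (finite_II N))) => _ [[n _ <-] MU].
  exists n => //=; rewrite ltnNge; apply/negP => /NU MU0.
  by move: MU; rewrite MU0 => -[].
have [A Ainf] : exists A, ~ finite_set (M @^-1` [set A]).
  apply: contrapT => H; apply: infinite_nat.
  rewrite (_ : [set: nat] = \bigcup_(A in range M) (M @^-1` [set A])).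
    apply: bigcup_finite => // A _; apply: contrapT => K; apply: H; by exists A.
  by apply/seteqP; split=> // n _; exists (M n) => //; exists n.
have [n MnA] : exists n, M n = A.
  apply: contrapT => H; apply: Ainf; apply: (sub_finite_set _ (@finite_set0 _)).
  by move=> n /= MnA; apply: H; exists n.
have [x Ax] := M0 n; have [U Ux [N NU]] := Mfin x; apply: Ainf.
apply: (sub_finite_set _ (finite_II N)) => m /= MmA.
rewrite ltnNge; apply/negP => /NU MU0.
have : (M m `&` U) x by rewrite MmA -MnA; split=> //; exact: nbhs_singleton.
by rewrite MU0.
Qed.

Lemma feebly_compact_Gamma_o X : quasi_regular X -> feebly_compact X ->
  Gamma_BM BM_o X.
Proof.
move=> Xqr Xf; apply: (@closure_goals _ _ (fun _ _ => True)) => //.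
  by move=> _ V oV V0; exists V; split=> //; split=> //; exact: subset_refl.
move=> V VV V0 cV _; split=> // M MV.
have [||x Mx] := feebly_compact_upper_lt (M := M) Xf.
- by move=> n; have [] := MV n.
- by move=> n; have [] := MV n.
exists x; split=> //; apply: (upper_lt_bigcap VV cV _ Mx).
by move=> n; have [] := MV n.
Qed.

(** * p-spaces *)
Lemma regular_set_type (T : uniformType) (A : set T) :
  regular_space (set_type A).
Proof. exact: uniform_regular. Qed.

Section PSpace.
Variables (R : realType) (X : topologicalType).

(* Products are studied over index types with decidable equality. *)
HB.instance Definition _ := gen_eqMixin (unit_fun R X).

Let cube : set (prod_topology (fun _ : unit_fun R X => R)) :=
  [set z | forall f, `[0%R, 1%R]%classic (z f)].

Lemma cube_compact : compact cube.
Proof.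
exact: (@tychonoff (unit_fun R X) (fun _ => R) (fun _ => `[0%R, 1%R]%classic)
  (fun _ => @segment_compact R 0%R 1%R)).
Qed.

Lemma coord_continuous (f : unit_fun R X) :
  continuous (fun z : prod_topology (fun _ : unit_fun R X => R) => z f).
Proof. exact: (@proj_continuous (unit_fun R X) (fun _ => R) f). Qed.

Lemma closure_eval_cube : closure (range (@unit_fun_eval R X)) `<=` cube.
Proof.
move=> z zcl f; have /closure_id -> : closed `[0%R, 1%R : R] by exact: interval_closed.
move=> W /coord_continuous /zcl [_ [[x _ <-] Wx]].
exists (proj1_sig f x); split=> //.
by have [_] := proj2_sig f; apply; exists x.
Qed.

Lemma stone_cech_compact : compact [set: stone_cech R X].
Proof.
move=> F FP _.
pose v : stone_cech R X -> prod_topology (fun _ : unit_fun R X => R) := set_val.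
have vF A B : F A -> A `<=` v @^-1` B -> (v @ F) B.
  by move=> FA AB; suff : F (v @^-1` B) by []; apply: filterS FA.
have [|z [_ vz]] := cube_compact (F := v @ F) _.
  by apply: (vF _ _ filterT) => y _; apply/closure_eval_cube/set_valP.
have zcl : closure (range (@unit_fun_eval R X)) z.
  move=> W /nbhs_interior Wz; have [|_ [[y _ <-] Wy]] := vz (range v) W° _ Wz.
    by apply: (vF _ _ filterT) => y _; exists y.
  have [|t [? Wt]] := set_valP y W°.
    by apply: open_nbhs_nbhs; split=> //; exact: open_interior.
  by exists t; split=> //; apply: interior_subset.
exists (SigSub (mem_set zcl)); split=> // A B FA [_ [[W oW <-] Wz WB]].
have [|_ [[y Ay <-] Wy]] := vz (v @` A) W _ (open_nbhs_nbhs (conj oW Wz)).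
  by apply: (vF _ _ FA) => y Ay; exists y.
by exists y; split=> //; apply: WB.
Qed.

Lemma stone_cech_in_continuous : continuous (@stone_cech_in R X).
Proof.
move=> x U [_ [[W oW <-] Wx WU]].
have ex : @unit_fun_eval R X @ x --> unit_fun_eval x.
  by apply: prod_cvg => f; have [fcont _] := proj2_sig f; exact: fcont.
have := ex W (open_nbhs_nbhs (conj oW Wx)).
rewrite !nbhs_simpl /=; apply: filterS => t Wt; exact: WU.
Qed.

(** Complete regularity makes the canonical map an embedding: a function that is 0
    at [x] and 1 off a neighborhood of [x] is a coordinate of the compactification. *)
Lemma stone_cech_in_cvg (F : set_system X) x : completely_regular_space X ->
  Filter F -> @stone_cech_in R X @ F --> stone_cech_in R x -> F --> x.
Proof.
move=> Xcr FF eF U /nbhs_interior Ux.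
have Uc : closed (~` U°) by apply: open_closedC; exact: open_interior.
have /(@uniform_separatorP X R) [f [fc f01 f0 f1]] :
    uniform_separator [set x] (~` U°).
  by apply: Xcr => //; apply; exact: nbhs_singleton Ux.
pose g : unit_fun R X := exist _ f (conj fc f01).
have eU : nbhs (stone_cech_in R x) [set y | set_val y g < 1]%R.
  have ox : open_nbhs (unit_fun_eval x)
      [set z : prod_topology (fun _ : unit_fun R X => R) | z g < 1]%R.
    split.
      apply: (@open_comp _ _
        (fun z : prod_topology (fun _ : unit_fun R X => R) => z g)
        [set r : R | (r < 1)%R]); last exact: open_lt.
      by move=> z _; exact: coord_continuous.
    have fx : f x = 0%R by apply: f0; exists x.
    by rewrite /= /unit_fun_eval /= fx ltr01.
  exists [set y : stone_cech R X | set_val y g < 1]%R; split=> //.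
    by exists [set z | z g < 1]%R; [exact: ox.1|].
  exact: ox.2.
have := eF _ eU; rewrite !nbhs_simpl /=; apply: filterS => t.
move=> ft; have {}ft : (f t < 1)%R := ft.
apply: interior_subset; apply: contrapT => Ut.
by move: ft; rewrite (f1 (f t)) ?ltxx //; exists t.
Qed.

Lemma stone_cech_regular : regular_space (stone_cech R X).
Proof. exact (@regular_set_type _ (closure (range (@unit_fun_eval R X)))). Qed.

(** An ultrafilter containing all moves converges in the compactification, to a
    point that lies in the star of [x] at every level and therefore in [X]. *)
Lemma p_space_Gamma_k : quasi_regular X -> p_space R X -> Gamma_BM BM_k X.
Proof.
move=> Xqr [Xcr _ [U [oU Ucov Ustar]]].
pose e := @stone_cech_in R X.
apply: (@closure_goals _ _
  (fun n A => exists2 B, U n B & closure (e @` A) `<=` B)) => //.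
- move=> n A B AB [C UC BC]; exists C => //; apply: subset_trans BC.
  exact/closureS/image_subset.
- move=> n V oV [x Vx]; have [B UB Bx] := Ucov n (e x) (imageT e x).
  have [C Cx CB] : filter_from (nbhs (e x)) closure B.
    by apply: stone_cech_regular; apply: open_nbhs_nbhs; split=> //; exact: oU UB.
  exists (V `&` (e @^-1` C)°); split.
    by apply: (legal_move_interior oV _ Vx); apply: stone_cech_in_continuous.
  exists B => //; apply: subset_trans CB; apply: closureS => _ [y [_ Cy] <-].
  exact: interior_subset Cy.
move=> V VV [x Vx] cV VU; apply: frakV_k_closure => //; first by exists x.
move=> G GU GV.
have := stone_cech_compact; rewrite compact_ultra.
move=> /(_ (e @ G) (ultra_fmap e GU) filterT) [z [_ Gz]].
have [] := Ustar x z.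
  move=> n _; have [B UB VB] := VU n; exists B.
    by split=> //; apply/VB/subset_closure; exists x => //; apply: Vx.
  apply: VB => W Wz; have GW : G (e @^-1` W) by exact: Gz Wz.
  have /filter_ex [y [Vy Wy]] : G (V n.+1 `&` e @^-1` W) by exact: filterI.
  by exists (e y); split=> //; exists y.
move=> m _ mz; exists m; apply: (stone_cech_in_cvg Xcr).
by rewrite mz.
Qed.

End PSpace.

End BanachMazurGames.

Theorem theorem3 (R : realType) :
  (* (1) *)
  (forall X : topologicalType,
     [/\ Gamma_BM BM_f X -> Gamma_BM BM_k X,
         Gamma_BM BM_k X -> Gamma_BM BM_p X
       & Gamma_BM BM_p X -> Gamma_BM BM_o X]) /\
  (* (2) *)
  (forall (r : BM_index) (X Y : topologicalType),
     r = BM_o \/ r = BM_p ->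
     Gamma_BM r X -> Gamma_BM BM_k Y -> Gamma_BM r (X * Y)%type) /\
  (* (3) *)
  (forall (r : BM_index) (X : nat -> topologicalType),
     r = BM_k \/ r = BM_f ->
     (forall n, Gamma_BM r (X n)) -> Gamma_BM r (prod_topology X)) /\
  (* (4) *)
  (forall (r : BM_index) (X : topologicalType) (U : set X),
     Gamma_BM r X -> open U -> Gamma_BM r (set_type U)) /\
  (* (5) *)
  (forall (r : BM_index) (X : topologicalType),
     locally_Gamma_BM r X -> Gamma_BM r X) /\
  (* (6) *)
  (forall X : topologicalType, quasi_regular X ->
     [/\ [\/ metrizable X R, Moore_space X, developable X
           | (semiregular X /\ sigma_space X) \/
             (semiregular X /\ has_countable_network X)] -> Gamma_BM BM_f X,
         [\/ compact [set: X]%classic, p_space R X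
           | semiregular X /\ strong_Sigma_space X] -> Gamma_BM BM_k X,
         [\/ countably_compact [set: X]%classic,
             semiregular X /\ Sigma_space X
           | wDelta_space X] -> Gamma_BM BM_p X
       & feebly_compact X -> Gamma_BM BM_o X]).
Proof.
split=> [X|].
  split; apply: Gamma_le; [exact: frakV_f_k|exact: frakV_k_p|exact: frakV_p_o].
split=> [r X Y [->|->]|].
- by apply: Gamma_setX => A B; exact: frakV_o_setX.
- by apply: Gamma_setX => A B; exact: frakV_p_setX.
split=> [r X [->|->]|].
- by apply: Gamma_prod => d; exact: frakV_k_box.
- by apply: Gamma_prod => d; exact: frakV_f_box.
split=> [r X U|]; first exact: Gamma_open_sub.
split=> [r X|X Xqr]; first exact: Gamma_locally.
split.
- move=> [/metrizable_developable|[_]| |[[Xsr]|[Xsr /countable_network_sigma]]].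
  + exact: developable_Gamma_f.
  + exact: developable_Gamma_f.
  + exact: developable_Gamma_f.
  + exact: semiregular_sigma_Gamma_f.
  + exact: semiregular_sigma_Gamma_f.
- move=> [|/p_space_Gamma_k|[_]].
  + exact: compact_Gamma_k.
  + by apply.
  + exact: strong_Sigma_space_Gamma_k.
- move=> [|[_]|].
  + exact: countably_compact_Gamma_p.
  + exact: Sigma_space_Gamma_p.
  + exact: wDelta_Gamma_p.
- exact: feebly_compact_Gamma_o.
Qed.
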